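(* Let $Y:\mathbb R^n\to\Gamma(TM)$ be a linear map, $\mathbf Z=(z,\mathbb Z)\in WG_p(\mathbb R^n)$, and $\mathbf X=(x,\mathbb X)\in WG_p(M)$ with starting point $x_0\in M$. Then the following are equivalent: 1. $\mathbf X$ solves the RDE $d\mathbf X_t=Y_{d\mathbf Z_t}(x_t)$ with $x(0)=x_0$. 2. For any finite-dimensional vector space $W$ and any $\alpha\in\Omega^1(M,W)$, $$\Big[\int\alpha(d\mathbf X)\Big]^1_{s,t}\simeq\alpha_{x_s}(Y_{z_{s,t}}(x_s))+[Y_a(x_s)\alpha(Y_b)]|_{a\otimes b=\mathbb Z_{s,t}}$$ and $$\Big[\int\alpha(d\mathbf X)\Big]^2_{s,t}\simeq[\alpha_{x_s}Y_a(x_s)\otimes\alpha_{x_s}Y_b(x_s)]|_{a\otimes b=\mathbb Z_{s,t}}.$$ 3. For any finite-dimensional vector space $W$ and any $f\in C^\infty(M,W)$, $$f(x_t)-f(x_s)\simeq(\mathcal Y_{\mathbf Z_{s,t}}f)(x_s):=(Y_{z_{s,t}}f)(x_s)+(Y_aY_bf)(x_s)|_{a\otimes b=\mathbb Z_{s,t}}$$ and $$(df\otimes df)\big([P_{x_s}\otimes P_{x_s}]\mathbb X_{s,t}\big)\simeq Y_af(x_s)\otimes Y_bf(x_s)|_{a\otimes b=\mathbb Z_{s,t}}.$$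
   Context: Fix $T>0$, $p\in[2,3)$ and a control $\omega$, i.e. a continuous superadditive function $\omega:\{(s,t):0\le s\le t\le T\}\to[0,\infty)$ vanishing on the diagonal and positive off it. For a finite-dimensional normed space $W$, $WG_p(W)$ is the set of pairs $\mathbf X=(x,\mathbb X)$ of continuous maps $x:[0,T]\to W$ (the trace) and $\mathbb X:\{0\le s\le t\le T\}\to W\otimes W$ such that, with $x_{s,t}=x_t-x_s$: $\mathbb X_{s,t}=\mathbb X_{s,u}+\mathbb X_{u,t}+x_{s,u}\otimes x_{u,t}$ for $s\le u\le t$; $\sup_{s<t}|x_{s,t}|/\omega(s,t)^{1/p}<\infty$ and $\sup_{s<t}|\mathbb X_{s,t}|/\omega(s,t)^{2/p}<\infty$; and the symmetric part of $\mathbb X_{s,t}$ equals $\frac12 x_{s,t}\otimes x_{s,t}$. Write $[\mathbf X]^1_{s,t}=x_{s,t}$, $[\mathbf X]^2_{s,t}=\mathbb X_{s,t}$. For continuous $g,h$ on $\{s\le t\}$, $g_{s,t}\simeq h_{s,t}$ means: there are $\delta>0$ and $C$ with $|g_{s,t}-h_{s,t}|\le C\,\omega(s,t)^{3/p}$ whenever $|t-s|\le\delta$. For bilinear $B$ and a tensor $A$, $B(a,b)|_{a\otimes b=A}$ denotes $\hat B(A)$, where $\hat B$ is the linear map on the tensor product with $\hat B(a\otimes b)=B(a,b)$. $E=\mathbb R^N$ and $M\subset E$ is an embedded submanifold of dimension $d$ (locally the zero set of a smooth map $F:U\to\mathbb R^{N-d}$, $U\subset E$ open, with surjective differential); $\tau_mM=\mathrm{Nul}(F'(m))\cong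 T_mM$, and $P_m$ is the orthogonal projection of $E$ onto $\tau_mM$. $\Gamma(TM)$ is the set of smooth $Y:M\to E$ with $Y(m)\in\tau_mM$; vector fields act on functions as derivations, and $Y_a(x_s)\alpha(Y_b)$ is the derivative along $Y_a(x_s)$ of the function $m\mapsto\alpha_m(Y_b(m))$. $\Omega^1(M,W)$ denotes smooth $W$-valued one-forms on $M$. Rough integral in $E$: for $U\subset E$ open, a smooth $\alpha:U\to\mathrm{Hom}(E,W)$ and $\mathbf X\in WG_p(E)$ with trace in $U$, $\int\alpha(d\mathbf X)$ is the unique $\mathbf V=(v,\mathbb V)\in WG_p(W)$ with $v_0=0$, $v_{s,t}\simeq\alpha(x_s)x_{s,t}+\alpha'(x_s)\mathbb X_{s,t}$ and $\mathbb V_{s,t}\simeq[\alpha(x_s)\otimes\alpha(x_s)]\mathbb X_{s,t}$, where $\alpha'(x)[v\otimes w]=(\partial_v\alpha)(x)w$. $WG_p(M)$ is the set of $\mathbf X\in WG_p(E)$ whose trace lies in $M$ and such that $\int\tilde\alpha(d\mathbf X)\equiv0$ for every finite-dimensional $W$ and every smooth $W$-valued one-form $\tilde\alpha$ on $E$ with $\tilde\alpha|_{TM}\equiv0$. For $\mathbf X\in WG_p(M)$ and $\alpha\in\Omega^1(M,W)$, $\int\alpha(d\mathbf X):=\int\tilde\alpha(d\mathbf X)$ for any smooth extension $\tilde\alpha$ of $\alpha$ to an open neighbourhood of $M$ in $E$ (independent of the choice). RDE on $M$: $\mathbf X\in WG_p(M)$ solves $d\mathbf X_t=Y_{d\mathbf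 Z_t}(x_t)$, $x(0)=x_0$, if $x(0)=x_0$, $$x_{s,t}\simeq Y_{z_{s,t}}(x_s)+(\partial_{Y_a}Y_b)(x_s)|_{a\otimes b=\mathbb Z_{s,t}},\qquad \mathbb X_{s,t}\simeq Y_a(x_s)\otimes Y_b(x_s)|_{a\otimes b=\mathbb Z_{s,t}}.$$ *)

(* Defs.v *)
From HB Require Import structures.
From mathcomp Require Import all_boot all_order all_algebra.
From mathcomp Require Import all_classical all_reals all_analysis.

Set Implicit Arguments.
Unset Strict Implicit.
Unset Printing Implicit Defensive.
Import Order.TTheory GRing.Theory Num.Theory.
Import numFieldNormedType.Exports.

Local Open Scope classical_set_scope.
Local Open Scope ring_scope.

(** * Tensors

    Finite-dimensional spaces are [R^k = 'rV[R]_k], elements of [R^k (x) R^k]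
    are [k x k] matrices, and a linear map [R^N -> R^k] is a matrix acting on
    row vectors from the right.  The norms are the library's max norms. *)

Definition tens (R : realType) (k : nat) (a b : 'rV[R]_k) : 'M[R]_k :=
  a^T *m b.

(** [bilin B A] is [B(a,b)|_{a (x) b = A}], for [B] bilinear: the value at [A]
    of the linear map sending [tens a b] to [B a b]. *)
Definition bilin (R : realType) (k : nat) (V : lmodType R)
    (B : 'rV[R]_k -> 'rV[R]_k -> V) (A : 'M[R]_k) : V :=
  \sum_(i < k) \sum_(j < k) A i j *: B (delta_mx 0 i) (delta_mx 0 j).

(** * Rough paths *)

Definition simplex (R : realType) (T : R) : set (R * R) :=
  [set st | 0 <= st.1 /\ st.1 <= st.2 /\ st.2 <= T].

Definition control (R : realType) (T : R) (w : R -> R -> R) : Prop :=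
  [/\ {within simplex T, continuous (fun st : R * R => w st.1 st.2)},
      forall s u t, 0 <= s -> s <= u -> u <= t -> t <= T ->
        w s u + w u t <= w s t,
      forall s, 0 <= s -> s <= T -> w s s = 0 &
      forall s t, 0 <= s -> s < t -> t <= T -> 0 < w s t].

Definition simeq (R : realType) (T p : R) (w : R -> R -> R)
    (V : normedModType R) (g h : R -> R -> V) : Prop :=
  exists delta C : R, 0 < delta /\
    forall s t, 0 <= s -> s <= t -> t <= T -> t - s <= delta ->
      `|g s t - h s t| <= C * w s t `^ (3 / p).

(** A candidate rough path is a pair (trace, second level); only the values on
    [0, T], resp. on [simplex T], are meaningful. *)
Definition rpath (R : realType) (k : nat) : Type :=
  ((R -> 'rV[R]_k) * (R -> R -> 'M[R]_k))%type.

Definition level1 (R : realType) (k : nat) (X : rpath R k) (s t : R) :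
  'rV[R]_k := X.1 t - X.1 s.

Definition level2 (R : realType) (k : nat) (X : rpath R k) (s t : R) :
  'M[R]_k := X.2 s t.

Definition WG (R : realType) (T p : R) (w : R -> R -> R) (k : nat)
    (X : rpath R k) : Prop :=
  {within `[0, T], continuous X.1} /\
  {within simplex T, continuous (fun st : R * R => X.2 st.1 st.2)} /\
  (forall s u t, 0 <= s -> s <= u -> u <= t -> t <= T ->
     level2 X s t =
     level2 X s u + level2 X u t + tens (level1 X s u) (level1 X u t)) /\
  (exists C : R, forall s t, 0 <= s -> s < t -> t <= T ->
     `|level1 X s t| <= C * w s t `^ (1 / p)) /\
  (exists C : R, forall s t, 0 <= s -> s < t -> t <= T ->
     `|level2 X s t| <= C * w s t `^ (2 / p)) /\
  (forall s t, 0 <= s -> s <= t -> t <= T ->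
     2^-1 *: (level2 X s t + (level2 X s t)^T) =
     2^-1 *: tens (level1 X s t) (level1 X s t)).

(** * Smooth maps, submanifolds *)

(** [iter_derive [:: v1; ...; vr] f] is ['D_v1 (... ('D_vr f))]. *)
Definition iter_derive (R : realType) (V W : normedModType R)
    (vs : seq V) (f : V -> W) : V -> W :=
  foldr (fun v (g : V -> W) => fun x => 'D_v g x) f vs.

(** [C^oo] on an open set [U]: every iterated directional derivative is
    differentiable (hence continuous) at every point of [U]. *)
Definition smooth_on (R : realType) (V W : normedModType R)
    (U : set V) (f : V -> W) : Prop :=
  forall (vs : seq V) (x : V), U x -> differentiable (iter_derive vs f) x.

(** [F] is a local defining map of [M] on the open neighbourhood [U] of [m]. *)
Definition local_equation (R : realType) (N d : nat) (M : set 'rV[R]_N)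
    (m : 'rV[R]_N) (U : set 'rV[R]_N) (F : 'rV[R]_N -> 'rV[R]_(N - d)) : Prop :=
  [/\ open U, U m, smooth_on U F,
      forall x, U x -> (M x <-> F x = 0) &
      forall x, U x -> forall y, exists v, 'd F x v = y].

Definition embedded_submanifold (R : realType) (N d : nat)
    (M : set 'rV[R]_N) : Prop :=
  (d <= N)%N /\
  forall m, M m -> exists U (F : 'rV[R]_N -> 'rV[R]_(N - d)),
    local_equation M m U F.

(** [tau d M m] is [Nul (F'(m))]; it does not depend on the choice of [F]. *)
Definition tau (R : realType) (N d : nat) (M : set 'rV[R]_N) (m : 'rV[R]_N) :
    set 'rV[R]_N :=
  [set v | exists U (F : 'rV[R]_N -> 'rV[R]_(N - d)),
     local_equation M m U F /\ 'd F m v = 0].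

Definition inner (R : realType) (N : nat) (u v : 'rV[R]_N) : R :=
  \sum_(i < N) u 0 i * v 0 i.

(** The orthogonal projection [P_m] onto [tau_m M]. *)
Definition tproj (R : realType) (N d : nat) (M : set 'rV[R]_N)
    (m v : 'rV[R]_N) : 'rV[R]_N :=
  get [set w | tau d M m w /\ forall u, tau d M m u -> inner (v - w) u = 0].

(** [g] is a smooth map on the open neighbourhood [U] of [m] that agrees with
    [f] on [M]. *)
Definition local_extension (R : realType) (N : nat) (W : normedModType R)
    (M : set 'rV[R]_N) (f : 'rV[R]_N -> W) (m : 'rV[R]_N)
    (U : set 'rV[R]_N) (g : 'rV[R]_N -> W) : Prop :=
  [/\ open U, U m, smooth_on U g & forall x, U x -> M x -> g x = f x].

(** [f \in C^oo(M, W)]; the values of [f] off [M] are irrelevant. *)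
Definition smooth_on_mfd (R : realType) (N : nat) (W : normedModType R)
    (M : set 'rV[R]_N) (f : 'rV[R]_N -> W) : Prop :=
  forall m, M m -> exists U g, local_extension M f m U g.

(** [mderive M f m v] is the derivative [df_m v] of [f \in C^oo(M, W)] along a
    vector [v] tangent to [M] at [m]: the derivative along [v] of any local
    smooth extension of [f], on the choice of which it does not depend. *)
Definition mderive (R : realType) (N : nat) (W : normedModType R)
    (M : set 'rV[R]_N) (f : 'rV[R]_N -> W) (m v : 'rV[R]_N) : W :=
  get [set y | exists U g, local_extension M f m U g /\ y = 'D_v g m].

(** [Gamma(TM)] *)
Definition vector_field (R : realType) (N d : nat) (M : set 'rV[R]_N)
    (Y : 'rV[R]_N -> 'rV[R]_N) : Prop :=
  smooth_on_mfd M Y /\ forall m, M m -> tau d M m (Y m).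

(** A linear map [R^n -> Gamma(TM)]; elements of [Gamma(TM)] are compared on
    [M] only. *)
Definition linear_vector_fields (R : realType) (n N d : nat)
    (M : set 'rV[R]_N) (Y : 'rV[R]_n -> 'rV[R]_N -> 'rV[R]_N) : Prop :=
  (forall a, vector_field d M (Y a)) /\
  (forall (c : R) a b m, M m -> Y (c *: a + b) m = c *: Y a m + Y b m).

(** The action of a vector field on functions on [M]. *)
Definition lie (R : realType) (N : nat) (W : normedModType R)
    (M : set 'rV[R]_N) (Y : 'rV[R]_N -> 'rV[R]_N) (f : 'rV[R]_N -> W) :
    'rV[R]_N -> W :=
  fun m => mderive M f m (Y m).

(** * One-forms and rough integrals *)

(** [A] extends the one-form [al] on [M] over [U].  Only the values
    [al m v] with [m \in M] and [v \in tau_m M] are meaningful. *)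
Definition form_extension (R : realType) (N d k : nat) (M : set 'rV[R]_N)
    (al : 'rV[R]_N -> 'rV[R]_N -> 'rV[R]_k)
    (U : set 'rV[R]_N) (A : 'rV[R]_N -> 'M[R]_(N, k)) : Prop :=
  [/\ open U, smooth_on U A &
      forall x v, U x -> M x -> tau d M x v -> v *m A x = al x v].

(** [Omega^1(M, R^k)]; linearity of [al m] on [tau_m M] is implied by the
    existence of the local extensions. *)
Definition one_form (R : realType) (N d k : nat) (M : set 'rV[R]_N)
    (al : 'rV[R]_N -> 'rV[R]_N -> 'rV[R]_k) : Prop :=
  forall m, M m -> exists U A, U m /\ form_extension d M al U A.

(** [V] is [int A(dX)]; [w *m 'D_v A x] is [A'(x)[v (x) w]]. *)
Definition is_rough_integral (R : realType) (T p : R) (w : R -> R -> R)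
    (N k : nat) (A : 'rV[R]_N -> 'M[R]_(N, k)) (X : rpath R N)
    (V : rpath R k) : Prop :=
  [/\ WG T p w V,
      V.1 0 = 0,
      simeq T p w (level1 V) (fun s t =>
        level1 X s t *m A (X.1 s) +
        bilin (fun a b => b *m 'D_a A (X.1 s)) (level2 X s t)) &
      simeq T p w (level2 V) (fun s t =>
        bilin (fun a b => tens (a *m A (X.1 s)) (b *m A (X.1 s)))
          (level2 X s t))].

Definition rpath0 (R : realType) (k : nat) : rpath R k :=
  (fun=> 0, fun _ _ => 0).

Definition WGM (R : realType) (T p : R) (w : R -> R -> R) (N d : nat)
    (M : set 'rV[R]_N) (X : rpath R N) : Prop :=
  [/\ WG T p w X,
      forall t, 0 <= t -> t <= T -> M (X.1 t) &
      forall (k : nat) (A : 'rV[R]_N -> 'M[R]_(N, k)),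
        smooth_on setT A ->
        (forall m v, M m -> tau d M m v -> v *m A m = 0) ->
        is_rough_integral T p w A X (rpath0 R k)].

(** [V] is [int al(dX)] for a one-form [al] on [M]. *)
Definition is_rough_integral_mfd (R : realType) (T p : R) (w : R -> R -> R)
    (N d k : nat) (M : set 'rV[R]_N) (al : 'rV[R]_N -> 'rV[R]_N -> 'rV[R]_k)
    (X : rpath R N) (V : rpath R k) : Prop :=
  exists U A, [/\ M `<=` U, form_extension d M al U A &
                  is_rough_integral T p w A X V].

(** * Rough differential equations on [M] *)

Definition solves_RDE (R : realType) (T p : R) (w : R -> R -> R) (n N : nat)
    (M : set 'rV[R]_N) (Y : 'rV[R]_n -> 'rV[R]_N -> 'rV[R]_N)
    (Z : rpath R n) (x0 : 'rV[R]_N) (X : rpath R N) : Prop :=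
  [/\ X.1 0 = x0,
      simeq T p w (level1 X) (fun s t =>
        Y (level1 Z s t) (X.1 s) +
        bilin (fun a b => lie M (Y a) (Y b) (X.1 s)) (level2 Z s t)) &
      simeq T p w (level2 X) (fun s t =>
        bilin (fun a b => tens (Y a (X.1 s)) (Y b (X.1 s))) (level2 Z s t))].

(* Main.v *)
Require Import Defs.
From HB Require Import structures.
From mathcomp Require Import all_boot all_order all_algebra.
From mathcomp Require Import all_classical all_reals all_analysis.
From mathcomp Require Import ring lra.

Set Implicit Arguments.
Unset Strict Implicit.
Unset Printing Implicit Defensive.
Import Order.TTheory GRing.Theory Num.Theory.
Import numFieldNormedType.Exports.

Local Open Scope classical_set_scope.
Local Open Scope ring_scope.

(** The relation [simeq] only concerns pairs of nearby times, so by
    compactness of [[0, T]] it may be tested near each point of the diagonal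
    ([simeqP]).  Near a time [s0] the trace stays in a neighbourhood of [x_s0] on
    which smooth extensions exist and have bounded derivatives, the increment [x_{s,t}] has order [w^(1/p)], the second level has order
    [w^(2/p)], and terms of order [w^(3/p)] are negligible.

    From the equation to the other two items.  If [X] solves the equation and
    [A] is a smooth matrix-valued map near [x_s0], then substituting the two
    expansions of [X] into [x_{s,t} A(x_s) + A'(x_s) X_{s,t}] and applying the
    Leibniz rule to [Y_b A] yields the expansion along the vector fields
    ([solution_one_form], [lie_mulmx]).  For item 2, [A] is the extension of
    the one-form.  For item 3, [A] is the Jacobian of a local extension [g] of
    [f]: a third-order Taylor expansion gives
    [g(x_t) - g(x_s) = Dg x_{s,t} + D^2 g (x_{s,t} (x) x_{s,t}) / 2] up to a
    negligible term, and since [D^2 g] is symmetric and the symmetric part of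
    the second level is [x_{s,t} (x) x_{s,t} / 2], the quadratic term is
    [D^2 g X_{s,t}] ([taylor_path]).

    Back to the equation.  Item 2 for the tautological one-form [v |-> v], whose
    integral is [X] up to the starting point, is the equation.  Item 3 for the identity gives the
    first-level expansion, and the second-level expansion for
    [(P (x) P) X_{s,t}] only; it remains to see that [X_{s,t}] differs
    negligibly from its tangential projection ([level2_projection]).  This is
    where [X] being a rough path on [M] enters: if a one-form [A] kills [TM], so
    do the forms [x_i A], and comparing the vanishing integrals of [A] and of
    all [x_i A] gives [X_{s,t} A(x_s) = O(w^(3/p))] and
    [x_{s,t} A(x_s) = O(w^(2/p))] ([conormal_order]).  Taking for [A] a cut-off
    of the differential of a local equation of [M] bounds one normal tensor
    factor; the other one follows because the symmetric part of the second
    level is known.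

    The tangent space and the derivative of a function on [M] are defined
    through a choice of local equation and of local extension.  They do not
    depend on it because the kernel of the differential of a local equation
    consists of limiting directions of points of [M] ([ker_tangent_dir]), along
    which two extensions of the same function have the same derivative
    ([mderiveE]). *)

(** * Calculus of smooth maps *)

Section smooth_calculus.
Variables (R : realType).

Lemma iter_derive_rcons (V W : normedModType R) (vs : seq V) v (f : V -> W) :
  iter_derive (rcons vs v) f = iter_derive vs ('D_v f).
Proof. by rewrite /iter_derive -cats1 foldr_cat. Qed.

Lemma smooth_on_derive (V W : normedModType R) (U : set V) (f : V -> W) v :
  smooth_on U f -> smooth_on U ('D_v f).
Proof. by move=> sf vs x Ux; rewrite -iter_derive_rcons; exact: sf. Qed.

Lemma smooth_on_differentiable (V W : normedModType R) (U : set V)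
    (f : V -> W) x : smooth_on U f -> U x -> differentiable f x.
Proof. by move=> sf Ux; exact: (sf [::]). Qed.

Lemma smooth_on_continuous (V W : normedModType R) (U : set V)
    (f : V -> W) x : smooth_on U f -> U x -> {for x, continuous f}.
Proof.
by move=> sf Ux; apply: differentiable_continuous; exact: (sf [::]).
Qed.

Lemma smooth_on_sub (V W : normedModType R) (U U' : set V) (f : V -> W) :
  U' `<=` U -> smooth_on U f -> smooth_on U' f.
Proof. by move=> U'U sf vs x /U'U; exact: sf. Qed.

(** Smoothness of order [n], the form on which the closure properties below
    can be proved by induction, since [cn_on n.+1] of [f] amounts to [cn_on n]
    of [f] and of its directional derivatives ([cn_onS]). *)
Definition cn_on (V W : normedModType R) (n : nat) (U : set V) (f : V -> W) :=
  forall vs x, (size vs <= n)%N -> U x -> differentiable (iter_derive vs f) x.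

Lemma smooth_onP (V W : normedModType R) (U : set V) (f : V -> W) :
  smooth_on U f <-> forall n, cn_on n U f.
Proof.
split=> [sf n vs x _|sf vs x]; first exact: sf.
by apply: (sf (size vs)).
Qed.

Lemma cn_onS (V W : normedModType R) n (U : set V) (f : V -> W) :
  cn_on n.+1 U f <-> cn_on n U f /\ forall v, cn_on n U ('D_v f).
Proof.
split=> [sf|[s0 sf] vs x].
  split=> [vs x s|v vs x s]; first by apply: sf; exact: leqW.
  by rewrite -iter_derive_rcons; apply: sf; rewrite size_rcons.
case/lastP: vs => [|vs v] s Ux; first exact: s0.
by rewrite iter_derive_rcons; apply: sf => //; rewrite size_rcons in s.
Qed.

(** The expansion of [f] at [x] is also one of [g], so that the two functions
    have the same differential by uniqueness. *)
Lemma near_eq_differentiable (V W : normedModType R) (f g : V -> W) x :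
  (\near x, f x = g x) -> differentiable f x -> differentiable g x.
Proof.
move=> fg /diff_locallyP [cdf fE]; have fgx := nbhs_singleton fg.
have gdf : g \o shift x = cst (g x) + 'd f x +o_ (0 : V) id.
  apply/eqaddoP => e e0; move/eqaddoP : fE => /(_ e e0).
  have : \forall h \near (0 : V), f (h + x) = g (h + x).
    by move: fg; rewrite (near_shift 0) subr0; apply: filterS => y.
  by apply: filterS2 => h /= fgh; rewrite !fctE /= -fgh -fgx.
by apply/diff_locallyP; rewrite (diff_unique cdf gdf).
Qed.

Lemma open_eq_near (V : normedModType R) (W : Type) (U : set V) (f g : V -> W) x :
  open U -> (forall x, U x -> f x = g x) -> U x -> \near x, f x = g x.
Proof. by move=> oU fg Ux; apply: filterS (open_nbhs_nbhs (conj oU Ux)). Qed.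

Lemma cn_on_ext (V W : normedModType R) n (U : set V) (f g : V -> W) :
  open U -> (forall x, U x -> f x = g x) -> cn_on n U f -> cn_on n U g.
Proof.
move=> oU; elim: n f g => [|n ih] f g fg.
  move=> cf [|//] x _ Ux; apply: near_eq_differentiable (cf [::] x _ Ux) => //.
  exact: open_eq_near Ux.
move=> /cn_onS [cf cdf]; apply/cn_onS; split=> [|v]; first exact: ih cf.
by apply: ih (cdf v) => x Ux; apply: near_eq_derive; exact: open_eq_near Ux.
Qed.

Lemma smooth_on_ext (V W : normedModType R) (U : set V) (f g : V -> W) :
  open U -> (forall x, U x -> f x = g x) -> smooth_on U f -> smooth_on U g.
Proof.
move=> oU fg /smooth_onP sf; apply/smooth_onP => n; exact: cn_on_ext (sf n).
Qed.

Lemma cn_onD (V W : normedModType R) n (U : set V) (f g : V -> W) :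
  open U -> cn_on n U f -> cn_on n U g -> cn_on n U (f + g).
Proof.
move=> oU; elim: n f g => [|n ih] f g.
  move=> cf cg [|//] x _ Ux.
  by apply: differentiableD; [exact: (cf [::])|exact: (cg [::])].
move=> /cn_onS [cf cdf] /cn_onS [cg cdg]; apply/cn_onS; split=> [|v].
  exact: ih.
apply: (cn_on_ext oU _ (ih _ _ (cdf v) (cdg v))) => x Ux.
by rewrite deriveD //; apply: diff_derivable; [exact: (cf [::])|exact: (cg [::])].
Qed.

Lemma cn_on_cst (V W : normedModType R) n (U : set V) (c : W) :
  cn_on n U (fun _ : V => c).
Proof.
elim: n c => [|n ih] c.
  by move=> [|//] x _ Ux; exact: differentiable_cst.
apply/cn_onS; split=> [|v]; first exact: ih.
rewrite (_ : 'D_v (fun _ : V => c) = fun _ => 0); first exact: ih.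
by apply/funext => x; exact: derive_cst.
Qed.

Lemma smooth_on_cst (V W : normedModType R) (U : set V) (c : W) :
  smooth_on U (fun _ : V => c).
Proof. by apply/smooth_onP => n; exact: cn_on_cst. Qed.

Lemma smooth_onD (V W : normedModType R) (U : set V) (f g : V -> W) :
  open U -> smooth_on U f -> smooth_on U g -> smooth_on U (fun x => f x + g x).
Proof.
move=> oU /smooth_onP sf /smooth_onP sg; apply/smooth_onP => n.
exact: (@cn_onD _ _ n U f g).
Qed.

Lemma smooth_on_sum (V W : normedModType R) (U : set V) (I : Type) (r : seq I)
    (P : pred I) (f : I -> V -> W) :
  open U -> (forall i, P i -> smooth_on U (f i)) ->
  smooth_on U (fun x => \sum_(i <- r | P i) f i x).
Proof.
move=> oU sf; rewrite (_ : (fun x => _) = \sum_(i <- r | P i) f i); last first.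
  by apply/funext => x; rewrite fct_sumE.
elim/big_ind : _ => //; first exact: smooth_on_cst.
by move=> g h; exact: smooth_onD.
Qed.

Section bilinear_maps.
Variables (V W1 W2 W : normedModType R) (b : {bilinear W1 -> W2 -> W}).
Hypothesis b_cts : continuous (fun p => b p.1 p.2).

Lemma differentiable_comp_bilin (f : V -> W1) (g : V -> W2) x :
  differentiable f x -> differentiable g x ->
  differentiable (fun x => b (f x) (g x)) x.
Proof.
move=> df dg.
apply: (@differentiable_comp _ _ _ _ (fun x => (f x, g x)) (fun p => b p.1 p.2)).
  exact: differentiable_pair.
exact: differentiable_bilin.
Qed.

Lemma derive_comp_bilin (f : V -> W1) (g : V -> W2) x v :
  differentiable f x -> differentiable g x ->
  'D_v (fun x => b (f x) (g x)) x = b ('D_v f x) (g x) + b (f x) ('D_v g x).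
Proof.
move=> df dg; rewrite deriveE; last exact: differentiable_comp_bilin.
rewrite (@diff_comp _ _ _ _ (fun x => (f x, g x)) (fun p => b p.1 p.2)); last 2 first.
- exact: differentiable_pair.
- exact: differentiable_bilin.
by rewrite /= diff_bilin //= diff_pair //= !deriveE // addrC.
Qed.

(** By the Leibniz rule each derivative of [b (f x) (g x)] is a sum of two terms
    of the same form. *)
Lemma cn_on_bilin n (U : set V) (f : V -> W1) (g : V -> W2) : open U ->
  cn_on n U f -> cn_on n U g -> cn_on n U (fun x => b (f x) (g x)).
Proof.
move=> oU; elim: n f g => [|n ih] f g.
  move=> cf cg [|//] x _ Ux.
  by apply: differentiable_comp_bilin; [exact: (cf [::])|exact: (cg [::])].
move=> /cn_onS [cf cdf] /cn_onS [cg cdg]; apply/cn_onS; split=> [|v].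
  exact: ih.
apply: (cn_on_ext oU _ (cn_onD oU (ih _ _ (cdf v) cg) (ih _ _ cf (cdg v)))) => x Ux.
by rewrite derive_comp_bilin //; [exact: (cf [::])|exact: (cg [::])].
Qed.

Lemma smooth_on_bilin (U : set V) (f : V -> W1) (g : V -> W2) : open U ->
  smooth_on U f -> smooth_on U g -> smooth_on U (fun x => b (f x) (g x)).
Proof.
move=> oU /smooth_onP sf /smooth_onP sg; apply/smooth_onP => n.
exact: cn_on_bilin.
Qed.

End bilinear_maps.

End smooth_calculus.

Lemma scale_is_bilinear (R : realType) (V : normedModType R) :
  bilinear_for
    (GRing.Scale.Law.clone _ _ *:%R _) (GRing.Scale.Law.clone _ _ *:%R _)
    (@GRing.scale R V).
Proof.
split=> [u'|u] a x y /=.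
- by rewrite scalerDl scalerA.
- by rewrite scalerDr !scalerA mulrC.
Qed.
HB.instance Definition _ (R : realType) (V : normedModType R) :=
  bilinear_isBilinear.Build R R V V _ _ (@GRing.scale R V)
  (@scale_is_bilinear R V).

Lemma mulmx_continuous (R : realType) m n p :
  continuous (fun q : 'M[R]_(m, n) * 'M[R]_(n, p) => q.1 *m q.2).
Proof.
move=> q; rewrite (_ : (fun q => _) = fun q : 'M[R]_(m, n) * 'M[R]_(n, p) =>
  \sum_i \sum_j (\sum_k q.1 i k * q.2 k j) *: delta_mx i j); last first.
  apply/funext => r; rewrite [LHS]matrix_sum_delta.
  by apply: eq_bigr => i _; apply: eq_bigr => j _; rewrite mxE.
have cvg_sum (T : Type) (F : set_system T) (I : finType) (V : normedModType R)
    (f : I -> T -> V) (l : I -> V) : Filter F ->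
    (forall i, f i x @[x --> F] --> l i) ->
    (\sum_i f i x) @[x --> F] --> \sum_i l i.
  by move=> FF fl; apply: cvg_big => //; exact: add_continuous.
apply: (cvg_sum _ (nbhs q)) => i; apply: (cvg_sum _ (nbhs q)) => j.
apply: cvgZr_tmp; apply: (cvg_sum _ (nbhs q) _ R) => k.
have cfst : {for q, continuous (@fst 'M[R]_(m, n) 'M[R]_(n, p))}.
  exact: cvg_fst.
have csnd : {for q, continuous (@snd 'M[R]_(m, n) 'M[R]_(n, p))}.
  exact: cvg_snd.
apply: cvgM.
  exact: (continuous_comp cfst (@coord_continuous _ _ _ i k _)).
exact: (continuous_comp csnd (@coord_continuous _ _ _ k j _)).
Qed.

Section smooth_instances.
Variable R : realType.

Lemma smooth_on_mulmx (V : normedModType R) m n p (U : set V)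
    (f : V -> 'M[R]_(m, n)) (g : V -> 'M[R]_(n, p)) : open U ->
  smooth_on U f -> smooth_on U g -> smooth_on U (fun x => f x *m g x).
Proof.
by move=> oU sf sg; apply: smooth_on_bilin => //; exact: mulmx_continuous.
Qed.

Lemma derive_mulmx (V : normedModType R) m n p
    (f : V -> 'M[R]_(m, n)) (g : V -> 'M[R]_(n, p)) x v :
  differentiable f x -> differentiable g x ->
  'D_v (fun x => f x *m g x) x = 'D_v f x *m g x + f x *m 'D_v g x.
Proof.
by move=> df dg; rewrite derive_comp_bilin //; exact: mulmx_continuous.
Qed.

Lemma smooth_onZ (V W : normedModType R) (U : set V)
    (f : V -> R) (g : V -> W) : open U ->
  smooth_on U f -> smooth_on U g -> smooth_on U (fun x => f x *: g x).
Proof.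
by move=> oU sf sg; apply: smooth_on_bilin => //; exact: scale_continuous.
Qed.

Lemma deriveZ_fun (V W : normedModType R) (f : V -> R) (g : V -> W) x v :
  differentiable f x -> differentiable g x ->
  'D_v (fun x => f x *: g x) x = 'D_v f x *: g x + f x *: 'D_v g x.
Proof.
by move=> df dg; rewrite derive_comp_bilin //; exact: scale_continuous.
Qed.

Lemma derive_entry (V : normedModType R) m n (f : V -> 'M[R]_(m, n)) i j x v :
  differentiable f x -> 'D_v (fun x => f x i j) x = ('D_v f x) i j.
Proof. by move=> df; rewrite derive_mx ?mxE //; exact: diff_derivable. Qed.

Lemma smooth_on_entry (V : normedModType R) m n (U : set V)
    (f : V -> 'M[R]_(m, n)) i j : open U ->
  smooth_on U f -> smooth_on U (fun x => f x i j).
Proof.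
move=> oU /smooth_onP sf; apply/smooth_onP => k; have {sf} := sf k.
elim: k f => [|k ih] f.
  move=> cf [|//] x _ Ux; have dfx : differentiable f x by exact: (cf [::]).
  apply: (@differentiable_comp _ _ _ _ f (fun A : 'M[R]_(m, n) => A i j)) => //.
  exact: differentiable_coord.
move=> /cn_onS [cf cdf]; apply/cn_onS; split=> [|v]; first exact: ih.
apply: (cn_on_ext oU _ (ih _ (cdf v))) => x Ux.
by rewrite derive_entry //; exact: (cf [::]).
Qed.

Lemma derive_row (N : nat) (W : normedModType R) (f : 'rV[R]_N -> W) x h :
  differentiable f x -> 'D_h f x = \sum_i h 0 i *: 'D_(delta_mx 0 i) f x.
Proof.
move=> df; rewrite deriveE // [in LHS](row_sum_delta h) linear_sum /=.
by apply: eq_bigr => i _; rewrite linearZ /= deriveE.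
Qed.

(** Linearity is needed for functions that are smooth on an open set only, so
    each differentiation step uses the previous identity on a whole
    neighbourhood. *)
Lemma iter_derive_lin (V W : normedModType R) (I : finType) (U : set V)
    (c : I -> R) (f : I -> V -> W) vs x :
  open U -> (forall i, smooth_on U (f i)) -> U x ->
  iter_derive vs (fun x => \sum_i c i *: f i x) x =
  \sum_i c i *: iter_derive vs (f i) x.
Proof.
move=> oU sf; elim: vs x => [//|v vs ih] x Ux /=.
rewrite (near_eq_derive _ (open_eq_near oU ih Ux)).
have df i : differentiable (iter_derive vs (f i)) x by exact: sf.
have dF (J : seq I) :
    differentiable (fun x => \sum_(i <- J) c i *: iter_derive vs (f i) x) x.
  have -> : (fun x => \sum_(i <- J) c i *: iter_derive vs (f i) x) =
     \sum_(i <- J) (c i *: iter_derive vs (f i)).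
    by apply/funext => y; rewrite fct_sumE.
  elim/big_ind : _ => //.
    by move=> *; exact: differentiableD.
  by move=> k _; exact: differentiableZ.
elim: (index_enum I) => [|i J ihJ].
  rewrite (_ : (fun x => _) = cst 0) ?derive_cst ?big_nil //.
  by apply/funext => y; rewrite big_nil.
rewrite big_cons -ihJ -deriveZ; last exact: diff_derivable.
rewrite -deriveD; last 2 first.
- by apply: diff_derivable; exact: differentiableZ.
- by apply: diff_derivable; exact: dF.
by congr ('D_v _ x); apply/funext => y; rewrite big_cons.
Qed.

Lemma continuous_near_bounded (T : topologicalType) (W : normedModType R)
    (f : T -> W) x :
  {for x, continuous f} -> exists2 C, 0 < C & \forall y \near x, `|f y| <= C.
Proof.
move=> cf; exists (`|f x| + 1); first by rewrite ltr_wpDl.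
have := (@cvgr_norm_le _ _ _ _ _ _ _ cf (`|f x| + 1)).
by apply; rewrite ltrDl.
Qed.

(** Iterated derivatives along one direction are homogeneous forms in that
    direction, with locally bounded coefficients. *)
Lemma iter_derive_bound (N : nat) (W : normedModType R) (U : set 'rV[R]_N)
    (f : 'rV[R]_N -> W) m n : open U -> smooth_on U f -> U m ->
  exists2 C, 0 < C & \forall y \near m, forall h,
    `|iter_derive (nseq n h) f y| <= C * `|h| ^+ n.
Proof.
move=> oU + Um; elim: n f => [|n ih] f sf.
  have [C C0 fC] := continuous_near_bounded (smooth_on_continuous sf Um).
  by exists C => //; apply: filterS fC => y fy h; rewrite expr0 mulr1.
have {}ih i : exists2 C, 0 < C & \forall y \near m, forall h,
    `|iter_derive (nseq n h) ('D_(delta_mx 0 i) f) y| <= C * `|h| ^+ n.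
  by apply: ih; exact: smooth_on_derive.
pose C i := sval (cid2 (ih i)).
have C0 i : 0 < C i by rewrite /C; case: cid2.
have fC : \forall y \near m, forall i h,
    `|iter_derive (nseq n h) ('D_(delta_mx 0 i) f) y| <= C i * `|h| ^+ n.
  apply: (@filter_forall _ _ (fun i : 'I_N => [set y | forall h,
    `|iter_derive (nseq n h) ('D_(delta_mx 0 i) f) y| <= C i * `|h| ^+ n])
    (nbhs m) _) => i.
  by rewrite /C; case: cid2.
exists (1 + \sum_i C i).
  by rewrite ltr_pwDl // sumr_ge0 // => i _; exact: ltW.
have nU := open_nbhs_nbhs (conj oU Um).
apply: filterS2 fC nU => y fC Uy h.
have -> : nseq n.+1 h = rcons (nseq n h) h by rewrite -cats1 -(nseqD n 1) addn1.
rewrite iter_derive_rcons.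
have -> : iter_derive (nseq n h) ('D_h f) y =
    iter_derive (nseq n h) (fun x => \sum_i h 0 i *: 'D_(delta_mx 0 i) f x) y.
  elim: (nseq n h) y Uy {fC} => [|v vs ihv] y Uy /=.
    by apply: derive_row; exact: smooth_on_differentiable Uy.
  by apply: near_eq_derive; exact: (open_eq_near oU).
rewrite (iter_derive_lin _ _ oU) //; last by move=> i; exact: smooth_on_derive.
rewrite (le_trans (ler_norm_sum _ _ _)) // mulrDl mul1r ler_wpDl ?exprn_ge0 //.
rewrite mulr_suml ler_sum // => i _; rewrite normrZ exprS mulrCA ler_pM //.
by rewrite [leRHS]/Num.Def.normr /= mx_normrE; exact: (le_bigmax _ _ (0, i)).
Qed.

Lemma is_derive_line (V W : normedModType R) (f : V -> W) y u s :
  differentiable f (y + s *: u) ->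
  is_derive s 1 (fun s => f (y + s *: u)) ('D_u f (y + s *: u)).
Proof.
move=> df; have dl : is_diff s (fun s : R => y + s *: u) (fun s => s *: u).
  have := is_diffD (is_diff_cst y s) (is_diff_scalel s u).
  by rewrite add0r.
have dc : differentiable (fun s : R => f (y + s *: u)) s.
  exact: (@differentiable_comp R R V W (fun s : R => y + s *: u) f s).
apply: DeriveDef; first exact: diff_derivable.
rewrite deriveE // (@diff_comp R R V W (fun s : R => y + s *: u) f s) //.
by rewrite diff_val /= scale1r deriveE.
Qed.

End smooth_instances.

(** * Symmetric second derivatives and third-order expansions *)

Section taylor.
Variable R : realType.

(** The mean value inequality in the shape in which it can be iterated to bound
    Taylor remainders. *)
Lemma MVT_bound (f f' : R -> R) (K : R) :
  (forall t : R, 0 <= t <= 1 -> is_derive t 1 f (f' t)) ->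
  f 0 = 0 -> (forall t : R, 0 <= t <= 1 -> `|f' t| <= K) ->
  forall t : R, 0 <= t <= 1 -> `|f t| <= K.
Proof.
move=> df f0 f'K t /andP[t0 t1].
have [||c] := @MVT_segment _ f f' 0 t t0.
- move=> x /[!in_itv] /= /andP[x0 xt]; apply: df.
  by rewrite (ltW x0) (le_trans (ltW xt)).
- apply: derivable_within_continuous => x /[!in_itv] /= /andP[x0 xt].
  by have [] := df x; rewrite ?x0 ?(le_trans xt).
rewrite in_itv /= => /andP[c0 ct]; rewrite f0 !subr0 => ->.
have c01 : 0 <= c <= 1 by rewrite c0 (le_trans ct).
rewrite normrM (ger0_norm t0) (le_trans (ler_piMr _ t1)) //.
exact: f'K.
Qed.

(** The remainder, as a function of the parameter of the segment, vanishes at 0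
    with its first two derivatives, and its third derivative is bounded by [K];
    three applications of [MVT_bound] on the unit interval bring the bound
    down to the remainder itself. *)
Lemma taylor3 (V : normedModType R) (f : V -> R) (U : set V) x h (K : R) :
  smooth_on U f -> (forall t : R, 0 <= t <= 1 -> U (x + t *: h)) ->
  (forall t : R, 0 <= t <= 1 -> `|iter_derive (nseq 3 h) f (x + t *: h)| <= K) ->
  `|f (x + h) - f x - 'D_h f x - 2^-1 * 'D_h ('D_h f) x| <= K.
Proof.
move=> sf Uxt f3.
(* [a1] and [a2] are the first and second derivatives of the remainder [a0]. *)
pose a2 (t : R) := 'D_h ('D_h f) (x + t *: h) - 'D_h ('D_h f) x.
pose a1 (t : R) := 'D_h f (x + t *: h) - 'D_h f x - t * 'D_h ('D_h f) x.
pose a0 (t : R) :=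
  f (x + t *: h) - f x - t * 'D_h f x - 2^-1 * t ^+ 2 * 'D_h ('D_h f) x.
have dline (g : V -> R) (t : R) : smooth_on U g -> 0 <= t <= 1 ->
    is_derive t 1 (fun t : R => g (x + t *: h)) ('D_h g (x + t *: h)).
  move=> sg t01; apply: is_derive_line; apply: smooth_on_differentiable sg _.
  exact: Uxt.
have s1 := smooth_on_derive h sf; have s2 := smooth_on_derive h s1.
have a2K t : 0 <= t <= 1 -> `|a2 t| <= K.
  apply: (@MVT_bound _ (fun t => iter_derive (nseq 3 h) f (x + t *: h))) => //.
  - move=> s s01; have d := dline _ _ s2 s01.
    by rewrite /a2; apply: is_derive_eq; rewrite subr0.
  - by rewrite /a2 scale0r addr0 subrr.
have a1K t : 0 <= t <= 1 -> `|a1 t| <= K.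
  apply: (@MVT_bound _ a2) => //.
  - move=> s s01; have d := dline _ _ s1 s01.
    rewrite /a1; apply: is_derive_eq.
    by rewrite /a2 subr0 scaler0 add0r; congr (_ - _); rewrite -[RHS]mulr1.
  - by rewrite /a1 scale0r addr0 subrr mul0r subrr.
have a0K t : 0 <= t <= 1 -> `|a0 t| <= K.
  apply: (@MVT_bound _ a1) => //.
  - move=> s s01; have d := dline _ _ sf s01.
    rewrite /a0; apply: is_derive_eq.
    rewrite /a1 /GRing.scale /=.
    by field.
  - by rewrite /a0 scale0r addr0 subrr mul0r expr0n /= mulr0 mul0r !subr0.
by have := a0K 1; rewrite /a0 scale1r mul1r expr1n mulr1; apply; rewrite ler01 lexx.
Qed.

(** The mean value theorem in the direction [u] turns the second difference
    into an increment of ['D_u f] along [t *: v], which the differentiability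
    of ['D_u f] at [x] evaluates up to [o(t)]. *)
Lemma schwarz_increment (V : normedModType R) (f : V -> R) (U : set V) x u v (e : R) :
  open U -> smooth_on U f -> U x -> 0 < e ->
  \forall t \near 0^'+,
    `|f (x + t *: u + t *: v) - f (x + t *: u) - f (x + t *: v) + f x
      - t ^+ 2 * 'D_v ('D_u f) x| <= e * t ^+ 2.
Proof.
move=> oU sf Ux e0.
pose c := `|u| + `|v| + 1; have c0 : 0 < c by rewrite ltr_wpDl // addr_ge0.
have su := smooth_on_derive u sf.
have du := smooth_on_differentiable su Ux.
(* The remainder is evaluated at two points of norm at most [t * c], which
   explains the constant. *)
have rem : \forall h \near (0 : V),
    `|'D_u f (h + x) - 'D_u f x - 'd ('D_u f) x h| <= e / (2 * c) * `|h|.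
  have /eqaddoP := diff_locally du => /(_ (e / (2 * c))).
  rewrite divr_gt0 ?mulr_gt0 // => /(_ isT); apply: filterS => h /=.
  by rewrite !fctE /= opprD addrA.
have nU : \forall h \near (0 : V), U (h + x).
  have : \forall y \near x, U y by exact: open_nbhs_nbhs.
  by rewrite (near_shift 0) subr0.
have [r r0 rP] : exists2 r, 0 < r & forall h, `|h| < r ->
    U (h + x) /\ `|'D_u f (h + x) - 'D_u f x - 'd ('D_u f) x h| <= e / (2 * c) * `|h|.
  have [r r0 rP] := iffLR (nbhs_ballP _ _) (filterI nU rem).
  exists r => // h hr; apply: rP.
  by rewrite -ball_normE /= sub0r normrN.
exists (r / c); first by rewrite /= divr_gt0.
move=> t /= tr t0; rewrite sub0r normrN gtr0_norm // ltr_pdivlMr // in tr.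
have small s b : 0 <= s <= t -> 0 <= b <= t -> `|s *: u + b *: v| <= t * (`|u| + `|v|).
  move=> /andP[s0 st] /andP[b0 bt]; rewrite (le_trans (ler_normD _ _)) // !normrZ.
  by rewrite mulrDr !ger0_norm // lerD // ler_wpM2r.
have smallr s b : 0 <= s <= t -> 0 <= b <= t -> `|s *: u + b *: v| < r.
  move=> hs hb; apply: le_lt_trans (small _ _ hs hb) _.
  by rewrite (le_lt_trans _ tr) // ler_wpM2l ?(ltW t0) // lerDl.
pose k (s : R) := f (x + t *: v + s *: u) - f (x + s *: u).
pose k' (s : R) := 'D_u f (x + t *: v + s *: u) - 'D_u f (x + s *: u).
have dk s : 0 <= s <= t -> is_derive s 1 k (k' s).
  move=> hs; apply: is_deriveB; apply: is_derive_line;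
    apply: smooth_on_differentiable sf _.
    rewrite -addrA addrC; apply: (rP _ _).1; rewrite addrC; apply: smallr => //.
    by rewrite lexx ltW.
  rewrite addrC; apply: (rP _ _).1; rewrite -[_ *: u]addr0 -(scale0r v).
  by apply: smallr; rewrite // lexx ltW.
have [||s] := @MVT _ k k' 0 t t0.
- by move=> s /[!in_itv] /= /andP[s0 st]; apply: dk; rewrite !ltW.
- apply: derivable_within_continuous => s /[!in_itv] /= st.
  by have [] := dk s st.
rewrite in_itv /= => /andP[s0 st] kE.
have hs : 0 <= s <= t by rewrite !ltW.
have -> : f (x + t *: u + t *: v) - f (x + t *: u) - f (x + t *: v) + f x = k' s * t.
  rewrite -[t in RHS]subr0 -kE /k scale0r !addr0 (addrAC x).
  by rewrite opprB addrA addrAC -!addrA; congr (_ + (_ + _)); rewrite addrC.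
have -> : 'D_v ('D_u f) x = 'd ('D_u f) x v by rewrite deriveE.
pose L := 'd ('D_u f) x; rewrite -/L.
have -> : k' s * t - t ^+ 2 * L v = t * (
   ('D_u f (s *: u + t *: v + x) - 'D_u f x - L (s *: u + t *: v)) -
   ('D_u f (s *: u + x) - 'D_u f x - L (s *: u))).
  rewrite /k' -[x + t *: v + _]addrA [x + (_ + _)]addrC (addrC (t *: v)).
  rewrite (addrC x) [L (_ + _)]linearD [L (t *: v)]linearZ /= /GRing.scale /=.
  by ring.
rewrite normrM gtr0_norm // expr2 mulrCA ler_pM2l //.
have h0 : (0 : R) <= 0 <= t by apply/andP; split=> //; exact: ltW.
have ht : 0 <= t <= t by apply/andP; split=> //; exact: ltW.
have su0 : s *: u = s *: u + 0 *: v by rewrite scale0r addr0.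
rewrite (le_trans (ler_normB _ _)) //.
rewrite (le_trans (lerD (rP _ (smallr s t hs ht)).2 (rP _ _).2)) //.
  by rewrite su0; exact: smallr.
have B2 : `|s *: u| <= t * (`|u| + `|v|) by rewrite su0; exact: small.
rewrite -mulrDr (le_trans (ler_wpM2l _ (lerD (small _ _ hs ht) B2))) //.
  by rewrite divr_ge0 ?mulr_ge0 // ltW.
rewrite mulrAC ler_pdivrMr ?mulr_gt0 // -subr_ge0.
rewrite (_ : _ - _ = 2 * (e * t)) ?mulr_ge0 ?(ltW e0) ?(ltW t0) //.
by rewrite /c; ring.
Qed.

(** The second difference of [schwarz_increment] is symmetric in [u] and [v], so
    both mixed derivatives are its limit after division by [t ^+ 2]. *)
Lemma schwarz_real (V : normedModType R) (f : V -> R) (U : set V) x u v :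
  open U -> smooth_on U f -> U x -> 'D_u ('D_v f) x = 'D_v ('D_u f) x.
Proof.
move=> oU sf Ux; apply/eqP; rewrite -subr_eq0 -normr_le0.
apply/ler_addgt0Pr => e e0; rewrite add0r.
have e20 : 0 < e / 2 by rewrite divr_gt0.
have [t [[t0 tuv] tvu]] := filter_ex (filterI (filterI (nbhs_right_gt 0)
  (schwarz_increment u v oU sf Ux e20)) (schwarz_increment v u oU sf Ux e20)).
have t20 : 0 < t ^+ 2 by rewrite exprn_gt0.
rewrite (addrAC x) (addrAC (f _)) in tvu.
move: ('D_u ('D_v f) x) ('D_v ('D_u f) x) tuv tvu => a b.
move: (f _) (f _) (f _) (f _) => f1 f2 f3 f4 tuv tvu.
rewrite -(ler_pM2r t20) -{1}(gtr0_norm t20) -normrM mulrBl.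
have -> : e * t ^+ 2 = e / 2 * t ^+ 2 + e / 2 * t ^+ 2 by field.
apply: le_trans (le_trans (ler_normB _ _) (lerD tuv tvu)).
by rewrite le_eqVlt; apply/orP; left; apply/eqP; congr (`|_|); ring.
Qed.

Lemma schwarz_mx (V : normedModType R) m n (f : V -> 'M[R]_(m, n)) (U : set V) x u v :
  open U -> smooth_on U f -> U x -> 'D_u ('D_v f) x = 'D_v ('D_u f) x.
Proof.
move=> oU sf Ux; apply/matrixP => i j.
have dD w : differentiable ('D_w f) x.
  exact: smooth_on_differentiable (smooth_on_derive w sf) Ux.
have DE w1 w2 : ('D_w1 ('D_w2 f) x) i j = 'D_w1 ('D_w2 (fun x => f x i j)) x.
  rewrite -derive_entry //; apply: near_eq_derive; apply: (open_eq_near oU) Ux.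
  by move=> y Uy; rewrite derive_entry //; exact: smooth_on_differentiable Uy.
rewrite [LHS]DE [RHS]DE.
exact: (@schwarz_real V _ U x u v oU (smooth_on_entry i j oU sf) Ux).
Qed.

End taylor.

Section taylor_mx.
Variable R : realType.

Lemma mx_norm_le m n (A : 'M[R]_(m, n)) (K : R) :
  0 <= K -> (forall i j, `|A i j| <= K) -> `|A| <= K.
Proof.
move=> K0 AK; rewrite [leLHS]/Num.Def.normr /= mx_normrE.
by apply: bigmax_le => // -[i j] _; exact: AK.
Qed.

Lemma mx_entry_le m n (A : 'M[R]_(m, n)) i j : `|A i j| <= `|A|.
Proof.
by rewrite [leRHS]/Num.Def.normr /= mx_normrE; exact: (le_bigmax _ _ (i, j)).
Qed.

Lemma iter_derive_entry (V : normedModType R) m n (U : set V)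
    (f : V -> 'M[R]_(m, n)) i j vs x : open U -> smooth_on U f -> U x ->
  iter_derive vs (fun x => f x i j) x = (iter_derive vs f x) i j.
Proof.
move=> oU sf; elim: vs x => [//|v vs ih] x Ux /=.
by rewrite (near_eq_derive _ (open_eq_near oU ih Ux)) derive_entry //; exact: sf.
Qed.

Lemma segment_ball N (m x y : 'rV[R]_N) (r t : R) :
  `|m - x| < r -> `|m - y| < r -> 0 <= t <= 1 ->
  `|m - (x + t *: (y - x))| < r.
Proof.
move=> mx my /andP[t0 t1].
have -> : m - (x + t *: (y - x)) = (1 - t) *: (m - x) + t *: (m - y).
  by apply/matrixP => i j; rewrite !mxE; ring.
rewrite (le_lt_trans (ler_normD _ _)) // !normrZ (ger0_norm t0) ger0_norm ?subr_ge0 //.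
have [->|tn0] := eqVneq t 0; first by rewrite subr0 mul1r mul0r addr0.
have {}t0 : 0 < t by rewrite lt_neqAle eq_sym tn0.
rewrite (_ : r = (1 - t) * r + t * r); last by ring.
apply: ler_ltD; last by rewrite ltr_pM2l.
by apply: ler_wpM2l; [rewrite subr_ge0|exact: ltW].
Qed.

(** Uniform over pairs of points near [m]: the third derivatives are bounded by
    [iter_derive_bound], and balls are convex. *)
Lemma taylor3_mx N p q (U : set 'rV[R]_N) (f : 'rV[R]_N -> 'M[R]_(p, q)) m :
  open U -> smooth_on U f -> U m -> exists2 C, 0 < C &
  exists2 r, 0 < r & forall x y, `|m - x| < r -> `|m - y| < r ->
    `|f y - f x - 'D_(y - x) f x - 2^-1 *: 'D_(y - x) ('D_(y - x) f) x|
      <= C * `|y - x| ^+ 3.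
Proof.
move=> oU sf Um; have [C C0 fC] := iter_derive_bound 3 oU sf Um.
exists C => //; have nU : \forall y \near m, U y by exact: open_nbhs_nbhs.
have [r r0 rP] := iffLR (nbhs_ballP _ _) (filterI nU fC).
exists r => // x y mx my; set h := y - x.
have segP (t : R) : 0 <= t <= 1 -> U (x + t *: h) /\ forall h',
    `|iter_derive (nseq 3 h') f (x + t *: h)| <= C * `|h'| ^+ 3.
  by move=> t01; apply: rP; rewrite -ball_normE /=; exact: segment_ball.
have Ux : U x by have := (segP 0); rewrite scale0r addr0 lexx ler01 => /(_ isT)[].
apply: mx_norm_le => [|i j]; first by rewrite mulr_ge0 ?exprn_ge0 // ltW.
rewrite !mxE.
have := @taylor3 _ _ (fun x => f x i j) U x h (C * `|h| ^+ 3).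
rewrite [x + h]addrC subrK.
have := iter_derive_entry i j [:: h] oU sf Ux.
have := iter_derive_entry i j [:: h; h] oU sf Ux.
rewrite /= => -> ->; apply.
- exact: smooth_on_entry.
- by move=> t /segP[].
- move=> t /segP[Ut tC]; apply: le_trans (tC h).
  apply: le_trans (mx_entry_le _ i j).
  by rewrite -(iter_derive_entry i j (nseq 3 h) oU sf Ut).
Qed.

End taylor_mx.

(** * Smooth cutoff functions *)

Section bump.
Variable R : realType.

(** [x^-n exp(-1/x)], extended by 0: these functions are closed under
    differentiation up to linear combinations ([flat_exp_is_derive]), which
    makes each of them smooth. *)
Definition flat_exp (n : nat) (x : R) : R :=
  if 0 < x then x^-1 ^+ n * expR (- x^-1) else 0.

Lemma flat_exp_ge0 n x : 0 <= flat_exp n x.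
Proof.
rewrite /flat_exp; case: ifP => // x0.
by rewrite mulr_ge0 ?expR_ge0 // exprn_ge0 // invr_ge0 ltW.
Qed.

(** With [y = 1/x], this is [y ^+ n.+1 <= n.+1 ^ n.+1 * exp y], a consequence of
    [1 + y / n.+1 <= exp (y / n.+1)].  Since the difference quotient at 0 of
    [flat_exp n] is [flat_exp n.+1], the bound shows that it tends to 0. *)
Lemma flat_exp_le n x : flat_exp n x <= n.+1%:R ^+ n.+1 * `|x|.
Proof.
rewrite /flat_exp; case: ifPn => [x0|_]; last by rewrite mulr_ge0 ?exprn_ge0.
rewrite gtr0_norm // expRN ler_pdivrMr ?expR_gt0 // mulrAC.
have c0 : 0 < n.+1%:R :> R by [].
have : (x^-1 / n.+1%:R) ^+ n.+1 <= expR x^-1.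
  have {2}-> : x^-1 = n.+1%:R * (x^-1 / n.+1%:R) by rewrite mulrC divfK ?gt_eqF.
  rewrite expRM_natl lerXn2r ?nnegrE ?expR_ge0 //.
    by rewrite divr_ge0 ?invr_ge0 ?ltW.
  by rewrite (le_trans _ (expR_ge1Dx _)) // lerDr.
rewrite expr_div_n ler_pdivrMr ?exprn_gt0 // => le1.
have -> : x^-1 ^+ n = x^-1 ^+ n.+1 * x.
  by rewrite exprSr -mulrA mulVf ?mulr1 ?gt_eqF.
by rewrite ler_pM2r // (le_trans le1) // mulrC.
Qed.

Lemma flat_exp_is_derive n (x : R) :
  is_derive x 1 (flat_exp n) (flat_exp n.+2 x - n%:R * flat_exp n.+1 x).
Proof.
have [x0|x0|->] := ltgtP x 0.
- rewrite /flat_exp ltNge ltW //= mulr0 subr0.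
  apply: near_eq_is_derive (is_derive_cst 0 x 1).
  near=> y; rewrite ltNge (_ : y <= 0) //.
  by apply/ltW; near: y; exact: lt_nbhsl.
- have xn0 : x != 0 by rewrite gt_eqF.
  pose f (u : R) := u ^+ n * expR (- u).
  apply: (@near_eq_is_derive _ _ _ (f \o (fun y => y^-1))).
    near=> y; rewrite /flat_exp (_ : 0 < y) //.
    by near: y; exact: lt_nbhsr.
  have dV : is_derive x 1 (fun y : R => y^-1) (- x ^- 2).
    apply: is_derive_eq; first exact: is_deriveV.
    by rewrite /GRing.scale /= mulr1.
  have df : is_derive x^-1 1 f (n%:R * x^-1 ^+ n.-1 * expR (- x^-1) -
      x^-1 ^+ n * expR (- x^-1)).
    have dX := DeriveDef (@exprn_derivable R n x^-1 1) (@exp_derive R n x^-1 1).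
    have dN := is_deriveN (is_derive_id x^-1 (1 : R)).
    have dE := is_derive1_comp (is_derive_expR (- x^-1)) dN.
    have d := is_deriveM dX dE; apply: (@is_derive_eq _ _ _ _ _ _ _ _ d).
    by rewrite /GRing.scale /=; ring.
  apply: is_derive_eq.
  rewrite /flat_exp x0 -exprVn; case: n {df f} => [|n] /=; first by ring.
  by rewrite !exprS; ring.
- rewrite /flat_exp ltxx mulr0 subr0.
  suff h0 : h^-1 *: (flat_exp n (h *: 1 + 0) - flat_exp n 0) @[h --> 0^'] --> 0.
    apply: DeriveDef; last exact: cvg_lim h0.
    by apply/cvg_ex; exists 0.
  have -> : (fun h : R => h^-1 *: (flat_exp n (h *: 1 + 0) - flat_exp n 0)) =
      flat_exp n.+1.
    apply/funext => h; rewrite /GRing.scale /= mulr1 addr0 /flat_exp ltxx subr0.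
    by case: ifP => _; rewrite ?mulr0 // exprS mulrA.
  apply: (@cvg_trans _ (flat_exp n.+1 @ nbhs (0 : R))); first exact: cvg_within_filter.
  apply/cvgr0Pnorm_le => e e0.
  pose K := n.+2%:R ^+ n.+2 : R; have K0 : 0 < K by rewrite exprn_gt0.
  have : \forall h \near (0 : R), `|h| <= K^-1 * e.
    by apply: nbhs0_le; rewrite mulr_gt0 ?invr_gt0.
  apply: filterS => h; rewrite ler_pdivlMl // => hK.
  by rewrite ger0_norm ?flat_exp_ge0 // (le_trans (flat_exp_le _ _)).
Unshelve. all: by end_near. Qed.

Lemma smooth_on_flat_exp (V : normedModType R) (U : set V) (q : V -> R) n :
  open U -> smooth_on U q -> smooth_on U (fun x => flat_exp n (q x)).
Proof.
move=> oU sq; apply/smooth_onP => k; elim: k n => [|k ih] n.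
  move=> [|//] x _ Ux /=.
  apply: (@differentiable_comp _ _ _ _ q (flat_exp n)).
    exact: smooth_on_differentiable Ux.
  by apply/derivable1_diffP; have [] := flat_exp_is_derive n (q x).
apply/cn_onS; split=> // v.
have cdq : cn_on k U ('D_v q).
  by have /smooth_onP := smooth_on_derive v sq; exact.
have cc : cn_on k U (fun _ : V => - n%:R : R) by exact: cn_on_cst.
have c1 := cn_on_bilin (@mul_continuous _) oU cc (ih n.+1).
have c2 := cn_onD oU (ih n.+2) c1.
have c3 := cn_on_bilin (@mul_continuous _) oU c2 cdq.
apply: (cn_on_ext oU _ c3) => x Ux.
have dq := smooth_on_differentiable sq Ux.
have df : derivable (flat_exp n) (q x) 1 by have [] := flat_exp_is_derive n (q x).
have Df : differentiable (flat_exp n) (q x) by apply/derivable1_diffP.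
have dc : differentiable (fun x => flat_exp n (q x)) x.
  exact: (@differentiable_comp R V R R q (flat_exp n)).
rewrite [RHS]deriveE // (@diff_comp R V R R q (flat_exp n)) //= !fctE /=.
have dE : 'd (flat_exp n) (q x) 1 =
    flat_exp n.+2 (q x) - n%:R * flat_exp n.+1 (q x).
  by rewrite -deriveE //; have [_ ->] := flat_exp_is_derive n (q x).
have -> : 'd (flat_exp n) (q x) ('d q x v) = 'd q x v *: 'd (flat_exp n) (q x) 1.
  by rewrite -linearZ /= [_ *: _]mulr1.
by rewrite dE deriveE // /GRing.scale /= mulrC mulNr.
Qed.

Lemma smooth_on_id (V : normedModType R) (U : set V) : smooth_on U (@id V).
Proof.
apply/smooth_onP => -[|n]; first by move=> [|//] x _ _; exact: ex_diff.
apply/cn_onS; split=> [|v].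
  elim: n => [|n ih]; first by move=> [|//] x _ _; exact: ex_diff.
  apply/cn_onS; split=> // v; rewrite (_ : 'D_v id = fun=> v); first exact: cn_on_cst.
  by apply/funext => x; exact: derive_id.
rewrite (_ : 'D_v id = fun=> v); first exact: cn_on_cst.
by apply/funext => x; exact: derive_id.
Qed.

(** [exp (-1/q)] where [q] is a squared radius minus the squared Euclidean
    distance to [m]: the function vanishes outside a Euclidean ball that is
    contained in a ball of the max norm, hence in [U]. *)
Lemma bump_exists N (U : set 'rV[R]_N) m : open U -> U m ->
  exists2 chi : 'rV[R]_N -> R, smooth_on setT chi &
  0 < chi m /\ forall x, ~ U x -> \forall y \near x, chi y = 0.
Proof.
move=> oU Um; have nU : \forall y \near m, U y by exact: open_nbhs_nbhs.
have [r r0 rP] := iffLR (nbhs_ballP _ _) nU.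
pose q (x : 'rV[R]_N) := (r / 2) ^+ 2 - \sum_i (x 0 i - m 0 i) * (x 0 i - m 0 i).
have sq : smooth_on setT q.
  have sd i : smooth_on setT (fun x : 'rV[R]_N => x 0 i + - m 0 i).
    apply: smooth_onD; [exact: openT| |exact: smooth_on_cst].
    apply: smooth_on_entry; [exact: openT|exact: smooth_on_id].
  have sS : smooth_on setT
      (fun x : 'rV[R]_N => \sum_i - 1 * ((x 0 i - m 0 i) * (x 0 i - m 0 i)) : R).
    apply: smooth_on_sum => [|i _]; first exact: openT.
    apply: (smooth_on_bilin (@mul_continuous _)); [exact: openT|exact: smooth_on_cst|].
    by apply: (smooth_on_bilin (@mul_continuous _)); [exact: openT|exact: sd|exact: sd].
  have := smooth_onD openT (@smooth_on_cst _ _ _ setT ((r / 2) ^+ 2)) sS.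
  congr smooth_on; apply/funext => x; rewrite /q -sumrN.
  by congr (_ + _); apply: eq_bigr => i _; rewrite mulN1r.
exists (fun x => flat_exp 0 (q x)); first exact: smooth_on_flat_exp openT sq.
split=> [|x Ux].
  have -> : q m = (r / 2) ^+ 2.
    by rewrite /q big1 ?subr0 // => i _; rewrite subrr mul0r.
  by rewrite /flat_exp exprn_gt0 ?divr_gt0 // expr0 mul1r expR_gt0.
have qx : q x < 0.
  rewrite ltNge; apply/negP; rewrite subr_ge0 => qr; apply: Ux; apply: rP.
  rewrite -ball_normE /=.
  apply: (@le_lt_trans _ _ (r / 2)); last by rewrite gtr_pMr // invf_lt1 // ltr1n.
  apply: mx_norm_le => [|i j]; first by rewrite divr_ge0 // ltW.
  rewrite -(@ler_pXn2r _ 2) ?nnegrE ?divr_ge0 ?(ltW r0) //.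
  rewrite -normrX ger0_norm ?sqr_ge0 // (le_trans _ qr) //.
  rewrite ord1 (bigD1 j) //= !mxE -expr2 -sqrrN opprB lerDl sumr_ge0 // => k _.
  by rewrite -expr2 sqr_ge0.
have cq : {for x, continuous q} by exact: smooth_on_continuous sq _.
have : \forall y \near x, q y < 0 by apply: (cvgr_lt _ cq).
by apply: filterS => y qy; rewrite /flat_exp ltNge ltW.
Qed.

End bump.

Section cutoff.
Variables (R : realType) (N k : nat).

(** At a point of [U] this is a product of smooth maps; every other point has a
    neighbourhood on which the product vanishes. *)
Lemma smooth_on_cutoff (U : set 'rV[R]_N) (chi : 'rV[R]_N -> R)
    (A : 'rV[R]_N -> 'M[R]_(N, k)) :
  open U -> smooth_on setT chi -> smooth_on U A ->
  (forall x, ~ U x -> \forall y \near x, chi y = 0) ->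
  smooth_on setT (fun x => chi x *: A x).
Proof.
move=> oU schi sA chi0 vs x _; have [Ux|nUx] := pselect (U x).
  have sU : smooth_on U (fun x => chi x *: A x).
    by apply: smooth_onZ => //; exact: smooth_on_sub schi.
  exact: sU.
pose W := interior [set y | chi y = 0].
have oW : open W by exact: open_interior.
have sW : smooth_on W (fun x => chi x *: A x).
  apply: (smooth_on_ext oW _ (@smooth_on_cst _ _ _ W 0)) => y Wy.
  by rewrite [chi y](nbhs_singleton Wy) scale0r.
exact: (sW vs x (chi0 x nUx)).
Qed.

End cutoff.

(** * Tangent vectors as limits of points of the submanifold *)

Section strict_differentiability.
Variable R : realType.

(** Continuity of the derivative at [m] makes the differential at [m] a good
    approximation of increments between any two points near [m], which is what
    a contraction argument needs. *)
Lemma strict_diff N p q (U : set 'rV[R]_N) (f : 'rV[R]_N -> 'M[R]_(p, q)) m e :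
  open U -> smooth_on U f -> U m -> 0 < e ->
  exists2 r, 0 < r & forall a b, `|m - a| < r -> `|m - b| < r ->
    `|f b - f a - 'd f m (b - a)| <= e * `|b - a|.
Proof.
(* [e'] bounds the variation of each of the [N] partial derivatives; [N.+1]
   rather than [N] keeps the quotient meaningful when [N] is 0. *)
move=> oU sf Um e0; pose e' := e / N.+1%:R.
have e'0 : 0 < e' by rewrite divr_gt0.
have df : differentiable f m by exact: smooth_on_differentiable Um.
have nU : \forall y \near m, U y by exact: open_nbhs_nbhs.
have nD : \forall y \near m, forall i : 'I_N,
    `|'D_(delta_mx 0 i) f m - 'D_(delta_mx 0 i) f y| <= e'.
  apply: (@filter_forall _ _ (fun i : 'I_N => [set y |
    `|'D_(delta_mx 0 i) f m - 'D_(delta_mx 0 i) f y| <= e']) (nbhs m) _) => i.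
  have := smooth_on_continuous (smooth_on_derive (delta_mx 0 i) sf) Um.
  by move/cvgrPdist_le; apply.
have [r r0 rP] := iffLR (nbhs_ballP _ _) (filterI nU nD).
exists r => // a b ma mb; set h := b - a.
have segP (t : R) : 0 <= t <= 1 -> U (a + t *: h) /\
    `|'D_h f (a + t *: h) - 'D_h f m| <= e * `|h|.
  move=> t01; have /rP[Ut Dt] : ball m r (a + t *: h).
    by rewrite -ball_normE /=; exact: segment_ball.
  split=> //; rewrite distrC !derive_row //; last exact: smooth_on_differentiable Ut.
  rewrite -sumrB (le_trans (ler_norm_sum _ _ _)) //.
  apply: (@le_trans _ _ (\sum_(i < N) `|h| * e')).
    apply: ler_sum => i _; rewrite -scalerBr normrZ ler_pM //.
    exact: mx_entry_le.
  rewrite sumr_const card_ord -mulr_natr.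
  have -> : `|h| * e' * N%:R = e * `|h| * (N%:R / N.+1%:R).
    by rewrite /e'; move: (N.+1%:R^-1) => c; ring.
  rewrite ler_piMr ?mulr_ge0 ?(ltW e0) // ler_pdivrMr // mul1r ler_nat.
  exact: leqnSn.
apply: mx_norm_le => [|i j]; first by rewrite mulr_ge0 // ltW.
pose k (t : R) := f (a + t *: h) i j - f a i j - t * ('D_h f m) i j.
pose k' (t : R) := ('D_h f (a + t *: h)) i j - ('D_h f m) i j.
have -> : (f b - f a - 'd f m h) i j = k 1.
  by rewrite /k scale1r mul1r /h [a + _]addrC subrK -deriveE // !mxE.
apply: (@MVT_bound _ k k'); last by rewrite ler01 lexx.
- move=> t /segP[Ut _].
  have dt : is_derive t 1 (fun t : R => f (a + t *: h) i j)
      ('D_h (fun x => f x i j) (a + t *: h)).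
    apply: (@is_derive_line R _ R (fun x => f x i j)).
    apply: smooth_on_differentiable Ut; exact: smooth_on_entry.
  rewrite derive_entry in dt; last exact: smooth_on_differentiable Ut.
  rewrite /k; apply: is_derive_eq.
  by rewrite /k' /GRing.scale /=; ring.
- by rewrite /k scale0r addr0 subrr mul0r subrr.
- move=> t /segP[_]; apply: le_trans; apply: le_trans (mx_entry_le _ i j).
  by rewrite !mxE.
Qed.

End strict_differentiability.

(* The contraction principle asks for a complete normed module, which joins the
   norm of matrices with their completeness as a uniform space. *)
HB.instance Definition _ (R : realType) m n :=
  Complete.copy 'M[R]_(m, n) 'M[R]_(m, n).

Section tangent.
Variable R : realType.

(** The tangent cone of [M] at [m], phrased without a parametrisation. *)
Definition tangent_dir N (M : set 'rV[R]_N) (m v : 'rV[R]_N) : Prop :=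
  forall e, 0 < e -> \forall t \near 0^'+,
    exists2 y, M y & `|y - (m + t *: v)| <= e * t.

(** The points [y = m + t v + o(t)] of [M] satisfy [g y = g m = 0], hence
    [t *: 'd g m v = o(t)]. *)
Lemma derive_tangent_dir N (W : normedModType R) (M : set 'rV[R]_N) m v
    (g : 'rV[R]_N -> W) :
  tangent_dir M m v -> differentiable g m -> M m ->
  (\forall y \near m, M y -> g y = 0) -> 'D_v g m = 0.
Proof.
move=> tv dg Mm g0; have gm : g m = 0 by exact: (nbhs_singleton g0).
apply/eqP; rewrite -normr_le0; apply/ler_addgt0Pr => e e0; rewrite add0r.
have [k k0 kP] : exists2 k, 0 < k & forall h, `|'d g m h| <= k * `|h|.
  have [k] := linear_lipschitz (diff_continuous dg).
  by move=> k0 kP; exists k.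
pose c := `|v| + 1; have c0 : 0 < c by rewrite ltr_wpDl.
pose eta := Num.min 1 (e / (2 * k)).
have eta0 : 0 < eta by rewrite lt_min ltr01 divr_gt0 ?mulr_gt0.
have rem : \forall y \near m, `|g y - g m - 'd g m (y - m)| <= e / (2 * c) * `|y - m|.
  have e20 : 0 < e / (2 * c) by rewrite divr_gt0 ?mulr_gt0.
  have /eqaddoP/(_ _ e20) := diff_locally dg.
  move=> H; rewrite (near_shift 0) subr0; apply: filterS H => y /=.
  by rewrite !fctE /= addrK opprD addrA.
have [r r0 rP] := iffLR (nbhs_ballP _ _) (filterI g0 rem).
have : \forall t \near 0^'+, t * c < r.
  near=> t; rewrite -ltr_pdivlMr //; near: t.
  by apply: nbhs_right_lt; rewrite divr_gt0.
move=> /(filterI (tv _ eta0)) /(filterI (nbhs_right_gt 0)) /filter_ex.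
move=> [t [t0 [[y My yP] tr]]].
have yb : `|y - m| <= t * c.
  rewrite (_ : y - m = (y - (m + t *: v)) + t *: v); last first.
    by rewrite opprD addrA subrK.
  rewrite (le_trans (ler_normD _ _)) // normrZ gtr0_norm // /c mulrDr mulr1 addrC.
  rewrite lerD2l (le_trans yP) // -[leRHS]mul1r ler_pM2r //.
  by rewrite ge_min lexx.
have /rP[/(_ My) gy] : ball m r y by rewrite -ball_normE /= distrC (le_lt_trans yb).
rewrite gy gm subrr sub0r normrN => dgy.
rewrite deriveE // -(ler_pM2l t0) -{1}(gtr0_norm t0) -normrZ -linearZ /=.
have -> : t *: v = (y - m) - (y - (m + t *: v)).
  by rewrite opprB addrC addrA subrK addrC addKr.
rewrite linearB (le_trans (ler_normB _ _)) //.
have -> : t * e = e / (2 * c) * (t * c) + k * (e / (2 * k) * t).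
  by field; rewrite !gt_eqF.
apply: lerD.
  by rewrite (le_trans dgy) // ler_wpM2l // divr_ge0 ?mulr_ge0 ?ltW.
rewrite (le_trans (kP _)) // ler_wpM2l ?(ltW k0) // (le_trans yP) //.
by rewrite ler_pM2r // ge_min lexx orbT.
Unshelve. all: by end_near. Qed.

Lemma surj_right_inverse N p (L : {linear 'rV[R]_N -> 'rV[R]_p}) :
  (forall y, exists v, L v = y) -> exists H : 'M[R]_(p, N),
    forall z, L (z *m H) = z.
Proof.
move=> sL; pose h i := sval (cid (sL (delta_mx 0 i))).
exists (\matrix_i h i) => z.
rewrite mulmx_sum_row linear_sum [RHS]row_sum_delta; apply: eq_bigr => i _.
by rewrite linearZ /= rowK /h; case: cid => v /= ->.
Qed.

Lemma mulmx_bounded m n p : exists2 K : R, 0 < K &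
  forall (A : 'M[R]_(m, n)) (B : 'M[R]_(n, p)), `|A *m B| <= K * `|A| * `|B|.
Proof.
by have [K K0 KP] := bilinear_schwarz (@mulmx_continuous R m n p); exists K.
Qed.

(** The chord method: with [H] a right inverse of [F'(m)], a zero of [F] of the
    form [m + t v + z H] is a fixed point of [z |-> z - F (m + t v + z H)].  This
    map is a contraction of a small ball since [F] is strictly differentiable,
    and the radius can be taken [o(t)] because [F (m + t v) = o(t)] when
    [F'(m) v = 0]. *)
Lemma ker_tangent_dir N d (M : set 'rV[R]_N) m U
    (F : 'rV[R]_N -> 'rV[R]_(N - d)) v :
  local_equation M m U F -> M m -> 'd F m v = 0 -> tangent_dir M m v.
Proof.
move=> [oU Um sF MF surj] Mm Fv e e0.
have Fm : F m = 0 by apply/MF.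
have [H HP] := surj_right_inverse (surj m Um).
have [K0 K00 K0P] := mulmx_bounded 1 (N - d) N.
pose K := K0 * `|H| + 1; have K_gt0 : 0 < K by rewrite ltr_wpDl // mulr_ge0 // ltW.
have KP (z : 'rV[R]_(N - d)) : `|z *m H| <= K * `|z|.
  apply: le_trans (K0P _ _) _.
  by rewrite /K mulrAC ler_wpM2r // lerDl.
pose rho := e / K; have rho0 : 0 < rho by rewrite divr_gt0.
(* The first bound makes the map 1/2-contracting; the second one keeps the image
   of 0 within half the radius [rho * t], so that the ball is sent into itself. *)
pose eta := Num.min (2 * K)^-1 (rho / 2 / (`|v| + 1)).
have v10 : 0 < `|v| + 1 by rewrite ltr_wpDl.
have eta0 : 0 < eta by rewrite lt_min invr_gt0 !divr_gt0 ?mulr_gt0.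
have [r r0 rP] := strict_diff oU sF Um eta0.
have [r' r'0 r'P] := iffLR (nbhs_ballP _ _) (open_nbhs_nbhs (conj oU Um)).
have : \forall t \near 0^'+, t * (`|v| + e) < Num.min r r'.
  have c0 : 0 < `|v| + e by rewrite ltr_wpDl.
  near=> t; rewrite -ltr_pdivlMr //; near: t.
  by apply: nbhs_right_lt; rewrite divr_gt0 // lt_min r0.
apply: filterS2 (nbhs_right_gt 0) => t t0; rewrite lt_min => /andP[tr tr'].
pose B : set 'rV[R]_(N - d) := [set z | `|z| <= rho * t].
have small z : B z -> `|m - (m + t *: v + z *m H)| <= t * (`|v| + e).
  move=> Bz; rewrite -addrA opprD addrA subrr sub0r normrN.
  rewrite (le_trans (ler_normD _ _)) // normrZ gtr0_norm // mulrDr lerD2l.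
  rewrite (le_trans (KP _)) // (le_trans (ler_wpM2l (ltW K_gt0) Bz)) //.
  by rewrite /rho mulrA mulrCA divff ?gt_eqF // mulr1 mulrC.
pose S z := z - F (m + t *: v + z *m H).
have B0 : B 0 by rewrite /B /= normr0 mulr_ge0 // ltW.
have SB z z' : B z -> B z' -> `|S z - S z'| <= 2^-1 * `|z - z'|.
  move=> Bz Bz'.
  have := rP _ _ (le_lt_trans (small _ Bz') tr) (le_lt_trans (small _ Bz) tr).
  have -> : m + t *: v + z *m H - (m + t *: v + z' *m H) = (z - z') *m H.
    by rewrite mulmxBl opprD addrACA subrr add0r.
  rewrite HP.
  have -> : S z - S z' =
      - (F (m + t *: v + z *m H) - F (m + t *: v + z' *m H) - (z - z')).
    rewrite /S; move: (F _) (F _) => f1 f2.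
    by apply/matrixP => i j; rewrite !mxE; ring.
  rewrite normrN => /le_trans; apply.
  rewrite (le_trans (ler_wpM2l (ltW eta0) (KP _))) // mulrA ler_wpM2r //.
  rewrite -ler_pdivlMr //; rewrite ge_min; apply/orP; left.
  by rewrite invfM.
have S0 : `|S 0| <= rho * t / 2.
  rewrite /S mul0mx addr0 sub0r normrN.
  have := rP m (m + t *: v); rewrite subrr normr0 r0 => /(_ isT).
  have := small 0 B0; rewrite mul0mx addr0 => /le_lt_trans -/(_ _ tr) h /(_ h).
  rewrite Fm subr0 (addrC m) addrK linearZ /= Fv scaler0 subr0 => /le_trans; apply.
  rewrite normrZ gtr0_norm // mulrCA.
  have -> : rho * t / 2 = t * (rho / 2 / (`|v| + 1) * (`|v| + 1)).
    by rewrite divfK ?gt_eqF //; ring.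
  rewrite ler_pM2l // ler_pM ?(ltW eta0) //; last by rewrite lerDl.
  by rewrite ge_min lexx orbT.
have SfunB : {homo S : z / B z >-> B z}.
  move=> z Bz; rewrite /B /=; have := SB _ _ Bz B0; rewrite subr0 => SzS0.
  rewrite -[S z](subrK (S 0)) (le_trans (ler_normD _ _)) //.
  rewrite (le_trans (lerD SzS0 S0)) //.
  have i2 : 0 <= 2^-1 :> R by rewrite invr_ge0.
  have zB := ler_wpM2l i2 Bz.
  rewrite (le_trans (lerD zB (lexx _))) //.
  by rewrite le_eqVlt; apply/orP; left; apply/eqP; field.
pose SF : {fun B >-> B} := mkfun_fun SfunB.
have ctr : is_contraction SF.
  have h0 : 0 <= 2^-1 :> R by [].
  exists (NngNum h0); split; first by rewrite /= invf_lt1 // ltr1n.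
  by move=> [z z'] /= [Bz Bz']; exact: SB.
have clB : closed B.
  have -> : B = closed_ball_ Num.norm 0 (rho * t).
    by apply/seteqP; split=> z; rewrite /B /closed_ball_ /= sub0r normrN.
  exact: closed_closed_ball_.
have [z Bz zE] := @banach_fixed_point _ _ B SF ctr clB (ex_intro _ 0 B0).
have Fz : F (m + t *: v + z *m H) = 0.
  move: zE => /eqP; rewrite /= /S eq_sym subr_eq addrC -subr_eq subrr eq_sym.
  by move/eqP.
exists (m + t *: v + z *m H).
  apply/MF => //; apply: r'P; rewrite -ball_normE /=.
  exact: le_lt_trans (small _ Bz) tr'.
rewrite addrC addKr (le_trans (KP _)) // (le_trans (ler_wpM2l (ltW K_gt0) Bz)) //.
by rewrite /rho mulrA mulrCA divff ?gt_eqF // mulr1.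
Unshelve. all: by end_near. Qed.

Lemma local_equation_sub N d (M : set 'rV[R]_N) m m' U
    (F : 'rV[R]_N -> 'rV[R]_(N - d)) :
  local_equation M m U F -> U m' -> local_equation M m' U F.
Proof. by move=> [oU _ sF MF surj] Um'; split. Qed.

Lemma local_extension_sub N (W : normedModType R) (M : set 'rV[R]_N)
    (f : 'rV[R]_N -> W) m m' U g :
  local_extension M f m U g -> U m' -> local_extension M f m' U g.
Proof. by move=> [oU _ sg gf] Um'; split. Qed.

(** One inclusion is the definition; for the other, a vector in the kernel for
    some local equation is a limiting direction of points of [M], where every
    local equation vanishes. *)
Lemma tauP N d (M : set 'rV[R]_N) m v U (F : 'rV[R]_N -> 'rV[R]_(N - d)) :
  local_equation M m U F -> M m -> tau d M m v <-> 'd F m v = 0.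
Proof.
move=> eF Mm; split=> [[U' [F' [eF' F'v]]]|Fv]; last by exists U, F.
have tv := ker_tangent_dir eF' Mm F'v.
have [oU Um sF MF _] := eF.
have dF : differentiable F m by exact: smooth_on_differentiable Um.
rewrite -deriveE //; apply: derive_tangent_dir tv dF Mm _.
apply: filterS (open_nbhs_nbhs (conj oU Um)) => y Uy My.
exact/MF.
Qed.

Lemma tau_tangent_dir N d (M : set 'rV[R]_N) m v :
  M m -> tau d M m v -> tangent_dir M m v.
Proof. by move=> Mm [U [F [eF Fv]]]; exact: ker_tangent_dir eF Mm Fv. Qed.

(** The difference of two local extensions vanishes on [M], hence so does its
    derivative along a limiting direction of points of [M]. *)
Lemma mderiveE N d (W : normedModType R) (M : set 'rV[R]_N)
    (f : 'rV[R]_N -> W) m U g v :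
  local_extension M f m U g -> M m -> tau d M m v -> mderive M f m v = 'D_v g m.
Proof.
move=> eg Mm tv; apply: get_unique; first by exists U, g.
move=> _ [U' [g' [eg' ->]]].
have [oU Um sg gf] := eg; have [oU' U'm sg' g'f] := eg'.
have dg : differentiable g m by exact: smooth_on_differentiable Um.
have dg' : differentiable g' m by exact: smooth_on_differentiable U'm.
apply/eqP; rewrite -subr_eq0 -deriveB; [|exact: diff_derivable..].
apply/eqP; apply: (derive_tangent_dir (tau_tangent_dir Mm tv)) Mm _.
  exact: differentiableB.
apply: filterS2 (open_nbhs_nbhs (conj oU Um)) (open_nbhs_nbhs (conj oU' U'm)).
by move=> y Uy U'y My; rewrite !fctE /= gf // g'f // subrr.
Qed.

End tangent.

(** * The orthogonal projection onto the tangent space *)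

Section jacobian_smooth.
Variable R : realType.

Lemma sum_delta_row m q (A : 'M[R]_(m, q)) :
  A = \sum_i (delta_mx i 0 : 'cV[R]_m) *m row i A.
Proof.
apply/row_matrixP => j; rewrite [RHS]rowE mulmx_sumr (bigD1 j) //.
rewrite big1 ?Monoid.mulm1 => [|i ij]; last first.
  by rewrite mulmxA mul_delta_mx_0 ?mul0mx // eq_sym.
rewrite mulmxA mul_delta_mx [delta_mx 0 0](_ : _ = 1%:M) ?mul1mx //.
by apply/matrixP => a b; rewrite !ord1 !mxE.
Qed.

Lemma jacobianE N k (f : 'rV[R]_N -> 'rV[R]_k) x : differentiable f x ->
  jacobian f x = \sum_i (delta_mx i 0 : 'cV[R]_N) *m 'D_(delta_mx 0 i) f x.
Proof.
move=> df; rewrite [LHS]sum_delta_row; apply: eq_bigr => i _.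
by rewrite rowE deriveEjacobian.
Qed.

Lemma smooth_on_jacobian N k (U : set 'rV[R]_N) (f : 'rV[R]_N -> 'rV[R]_k) :
  open U -> smooth_on U f -> smooth_on U (jacobian f).
Proof.
move=> oU sf.
have sS : smooth_on U (fun x => \sum_i (delta_mx i 0 : 'cV[R]_N) *m 'D_(delta_mx 0 i) f x).
  apply: smooth_on_sum => // i _; apply: smooth_on_mulmx => //.
    exact: smooth_on_cst.
  exact: smooth_on_derive.
apply: (smooth_on_ext oU _ sS) => x Ux.
by rewrite jacobianE //; exact: smooth_on_differentiable Ux.
Qed.

End jacobian_smooth.

Section inner_product.
Variables (R : realType) (N : nat).
Implicit Types u v w : 'rV[R]_N.

Lemma innerE u v : inner u v = (u *m v^T) 0 0.
Proof. by rewrite mxE; apply: eq_bigr => i _; rewrite mxE. Qed.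

Lemma innerDl u v w c : inner (c *: u + v) w = c * inner u w + inner v w.
Proof. by rewrite !innerE mulmxDl -scalemxAl !mxE. Qed.

Lemma innerC u v : inner u v = inner v u.
Proof. by apply: eq_bigr => i _; rewrite mulrC. Qed.

Lemma innerBl u v w : inner (u - v) w = inner u w - inner v w.
Proof. by rewrite !innerE mulmxBl !mxE. Qed.

Lemma norm_inner u : `|u| ^+ 2 <= inner u u.
Proof.
have i0 : 0 <= inner u u by rewrite sumr_ge0 // => i _; rewrite -expr2 sqr_ge0.
rewrite -(sqr_sqrtr i0) lerXn2r ?nnegrE ?sqrtr_ge0 //.
apply: mx_norm_le => [|i j]; first exact: sqrtr_ge0.
rewrite ord1 -sqrtr_sqr ler_wsqrtr // /inner (bigD1 j) //= expr2 lerDl.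
by rewrite sumr_ge0 // => k _; rewrite -expr2 sqr_ge0.
Qed.

Lemma inner_eq0 u : inner u u = 0 -> u = 0.
Proof.
move=> u0; apply/eqP; rewrite -normr_eq0 -sqrf_eq0 eq_le sqr_ge0 andbT.
by rewrite -u0 norm_inner.
Qed.

Lemma inner_le u v : inner u v <= N%:R * (`|u| * `|v|).
Proof.
apply: (@le_trans _ _ (\sum_(i < N) `|u| * `|v|)).
  apply: ler_sum => i _; rewrite (le_trans (ler_norm _)) // normrM.
  by rewrite ler_pM // mx_entry_le.
by rewrite sumr_const card_ord mulr_natl.
Qed.

(** The orthogonal complement of the kernel of [G] is the row space of [G^T],
    which gives the explicit projection [1 - G (G^T G)^-1 G^T]; [G^T G] is
    invertible because [c G^T G = 0] makes [c G^T] orthogonal to itself. *)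
Lemma orth_proj_exists q (G : 'M[R]_(N, q)) (H : 'M[R]_(q, N)) v :
  H *m G = 1%:M ->
  exists w, w *m G = 0 /\ forall u, u *m G = 0 -> inner (v - w) u = 0.
Proof.
move=> HG.
have unitGG : G^T *m G \in unitmx.
  rewrite -row_free_unit; apply: inj_row_free => c; rewrite mulmxA => cG.
  have : c *m G^T = 0.
    by apply: inner_eq0; rewrite innerE trmx_mul trmxK mulmxA cG mul0mx mxE.
  move/(congr1 (mulmx^~ H^T)); rewrite -mulmxA -trmx_mul HG trmx1 mulmx1.
  by rewrite mul0mx.
exists (v - v *m G *m invmx (G^T *m G) *m G^T); split=> [|u uG].
  by rewrite mulmxBl -[_ *m G^T *m G]mulmxA mulmxKV // subrr.
rewrite opprB addrC subrK innerC innerE trmx_mul trmxK mulmxA uG mul0mx.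
by rewrite mxE.
Qed.

(** Coercivity of [G] on the orthogonal complement of its kernel, with constants
    that stay fixed when [G] moves a little: [H] is a fixed approximate inverse.
    Correcting it, one finds [w] with [w *m G = u *m G] and [|w|] controlled;
    as [u] is orthogonal to [u - w], its Euclidean length is at most that of [w]. *)
Lemma orth_norm_le q (G : 'M[R]_(N, q)) (H : 'M[R]_(q, N)) (K : R) u :
  (forall z : 'rV_q, `|z - z *m H *m G| <= 2^-1 * `|z|) ->
  (forall z : 'rV_q, `|z *m H| <= K * `|z|) -> 0 < K ->
  (forall y, y *m G = 0 -> inner u y = 0) ->
  `|u| <= N%:R * K * 2 * `|u *m G|.
Proof.
move=> HG HK K0 uG.
have unitHG : H *m G \in unitmx.
  rewrite -row_free_unit; apply: inj_row_free => c; rewrite mulmxA => cHG.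
  have := HG c; rewrite cHG subr0 => c2; apply/eqP; rewrite -normr_eq0.
  by apply/eqP; have := normr_ge0 c; lra.
pose z := u *m G *m invmx (H *m G); pose w := z *m H.
have zE : z *m H *m G = u *m G by rewrite -mulmxA mulmxKV.
have z2 : `|z| <= 2 * `|u *m G|.
  have := ler_normD (z - u *m G) (u *m G); rewrite subrK.
  by have := HG z; rewrite zE; lra.
have uw0 : inner u (u - w) = 0 by apply: uG; rewrite mulmxBl /w zE subrr.
have uw : inner u u = inner w u.
  by apply/eqP; rewrite -subr_eq0 -innerBl innerC uw0.
have := norm_inner u; rewrite uw [inner _ _]innerC => le1.
have {le1} le2 := le_trans le1 (inner_le _ _).
have [u0|u0] := eqVneq u 0; first by rewrite u0 normr0 mulr_ge0 // !mulr_ge0 // ltW.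
have {}u0 : 0 < `|u| by rewrite normr_gt0.
have le3 : `|u| <= N%:R * `|w| by rewrite -(ler_pM2l u0) -expr2 mulrCA.
rewrite (le_trans le3) // -!mulrA ler_wpM2l // (le_trans (HK z)) //.
by rewrite ler_wpM2l // ltW.
Qed.

End inner_product.

Section tangent_projection.
Variables (R : realType) (N d : nat) (M : set 'rV[R]_N).
Hypothesis embM : embedded_submanifold d M.

Lemma tau_jacobianP m v U (F : 'rV[R]_N -> 'rV[R]_(N - d)) :
  local_equation M m U F -> M m -> tau d M m v <-> v *m jacobian F m = 0.
Proof. by move=> eF Mm; rewrite (tauP v eF Mm) mul_rV_lin1. Qed.

Lemma jacobian_left_inverse m U (F : 'rV[R]_N -> 'rV[R]_(N - d)) :
  local_equation M m U F -> exists H, H *m jacobian F m = 1%:M.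
Proof.
move=> [_ Um _ _ surj]; have [H HP] := surj_right_inverse (surj m Um).
exists H; apply/row_matrixP => i.
by rewrite !rowE mulmx1 mulmxA -[RHS](HP (delta_mx 0 i)) mul_rV_lin1.
Qed.

Lemma tproj_spec m v : M m ->
  tau d M m (tproj d M m v) /\
  forall u, tau d M m u -> inner (v - tproj d M m v) u = 0.
Proof.
move=> Mm; have [_ /(_ m Mm)[U [F eF]]] := embM.
have [H HG] := jacobian_left_inverse eF.
have [w [wG wP]] := orth_proj_exists v HG.
suff : [set w | tau d M m w /\ forall u, tau d M m u -> inner (v - w) u = 0]
   (tproj d M m v) by [].
apply: getPex; exists w; split; first exact/(tau_jacobianP _ eF Mm).
by move=> u /(tau_jacobianP _ eF Mm); exact: wP.
Qed.

Lemma tau_lin m c u v : M m -> tau d M m u -> tau d M m v ->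
  tau d M m (c *: u + v).
Proof.
move=> Mm; have [_ /(_ m Mm)[U [F eF]]] := embM.
rewrite !(tau_jacobianP _ eF Mm) => u0 v0.
by rewrite mulmxDl -scalemxAl u0 v0 scaler0 addr0.
Qed.

Lemma tproj_unique m v w : M m -> tau d M m w ->
  (forall u, tau d M m u -> inner (v - w) u = 0) -> tproj d M m v = w.
Proof.
move=> Mm tw wP; have [tp pP] := tproj_spec v Mm.
apply/eqP; rewrite -subr_eq0; apply/eqP/inner_eq0.
have tpw : tau d M m (tproj d M m v - w).
  by rewrite addrC -scaleN1r; exact: tau_lin.
have E : tproj d M m v - w = (v - w) - (v - tproj d M m v).
  by rewrite opprB [RHS]addrC subrKA.
by rewrite [X in inner X _]E innerBl wP // pP // subrr.
Qed.

Lemma tproj_id m v : M m -> tau d M m v -> tproj d M m v = v.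
Proof.
move=> Mm tv; apply: tproj_unique => // u _.
by rewrite subrr innerE mul0mx mxE.
Qed.

Lemma tproj_lin m c u v : M m ->
  tproj d M m (c *: u + v) = c *: tproj d M m u + tproj d M m v.
Proof.
move=> Mm; have [tu uP] := tproj_spec u Mm; have [tv vP] := tproj_spec v Mm.
apply: tproj_unique => //; first exact: tau_lin.
move=> y ty; rewrite opprD addrACA -scalerBr innerDl uP // vP //.
by rewrite mulr0 addr0.
Qed.

Lemma tproj_norm m v : M m -> `|tproj d M m v| <= N%:R * `|v|.
Proof.
move=> Mm; have [tv vP] := tproj_spec v Mm; set w := tproj d M m v.
have [->|w0] := eqVneq w 0; first by rewrite normr0 mulr_ge0.
have {}w0 : 0 < `|w| by rewrite normr_gt0.
rewrite -(ler_pM2l w0) -expr2 (le_trans (norm_inner w)) //.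
have /eqP := vP _ tv; rewrite -/w innerBl subr_eq0 => /eqP <-.
by rewrite (le_trans (inner_le _ _)) // mulrA mulrC [N%:R * _]mulrC mulrA.
Qed.

(** The normal component of [v] is controlled by the value on [v] of the
    differential of a local equation, uniformly near [m]: the left inverse of
    the Jacobian at [m] serves at all nearby points in [orth_norm_le]. *)
Lemma tproj_residual m U (F : 'rV[R]_N -> 'rV[R]_(N - d)) :
  local_equation M m U F -> exists2 C, 0 < C & \forall x \near m, M x ->
    forall v, `|v - tproj d M x v| <= C * `|v *m jacobian F x|.
Proof.
move=> eF; have [H HG] := jacobian_left_inverse eF.
have [oU Um sF _ _] := eF.
have cJ : {for m, continuous (jacobian F)}.
  exact: smooth_on_continuous (smooth_on_jacobian oU sF) Um.
have [K0 K00 K0P] := mulmx_bounded R 1 (N - d) N.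
have [K1 K10 K1P] := mulmx_bounded R 1 N (N - d).
pose K := K0 * `|H| + 1; have K_gt0 : 0 < K by rewrite ltr_wpDl // mulr_ge0 // ltW.
have KP (z : 'rV[R]_(N - d)) : `|z *m H| <= K * `|z|.
  apply: le_trans (K0P _ _) _.
  by rewrite /K mulrAC ler_wpM2r // lerDl.
exists (N%:R * K * 2 + 1); first by rewrite ltr_wpDl // !mulr_ge0 // ltW.
have e0 : 0 < (2 * (K1 * K))^-1 by rewrite invr_gt0 !mulr_gt0.
move/cvgrPdist_le : cJ => /(_ _ e0).
apply: filterS2 (open_nbhs_nbhs (conj oU Um)) => x Ux Jx Mx v.
have eFx := local_equation_sub eF Ux.
have [tv vP] := tproj_spec v Mx.
have Gv : (v - tproj d M x v) *m jacobian F x = v *m jacobian F x.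
  by rewrite mulmxBl (iffLR (tau_jacobianP _ eFx Mx) tv) subr0.
rewrite -Gv mulrDl mul1r ler_wpDr //.
apply: (orth_norm_le (H := H)) => // [z|y yG].
  rewrite -{1}[z]mulmx1 -HG mulmxA -mulmxBr (le_trans (K1P _ _)) //.
  rewrite (le_trans (ler_wpM2l _ Jx)) ?mulr_ge0 ?(ltW K10) //.
  rewrite ler_pdivrMr ?mulr_gt0 //.
  have -> : 2^-1 * `|z| * (2 * (K1 * K)) = K1 * (K * `|z|) by field.
  by rewrite ler_pM2l.
exact/vP/(tau_jacobianP _ eFx Mx).
Qed.

End tangent_projection.

(** * Orders of magnitude near the diagonal *)

Section orders.
Variables (R : realType) (T p : R) (w : R -> R -> R).
Hypothesis (T_gt0 : 0 < T) (p_gt0 : 0 < p) (w_control : control T w).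

Definition near_diag (s0 : R) : set_system (R * R) :=
  within (simplex T) (nbhs (s0, s0)).

Global Instance near_diag_filter s0 : Filter (near_diag s0).
Proof. exact: within_filter. Qed.

(** [e s t = O(w s t ^ (q / p))] as [s] and [t] tend to [s0]. *)
Definition ctrlO (V : normedModType R) (s0 : R) (q : nat) (e : R -> R -> V) :=
  exists C, \forall st \near near_diag s0,
    `|e st.1 st.2| <= C * w st.1 st.2 `^ (q%:R / p).

Lemma control_ge0 s t : simplex T (s, t) -> 0 <= w s t.
Proof.
move=> [/= s0 [st tT]]; have [_ _ w0 wp] := w_control.
have [->|sn] := eqVneq s t; first by rewrite w0 // (le_trans s0).
by apply/ltW/wp => //; rewrite lt_neqAle sn.
Qed.

Lemma control_le s t : simplex T (s, t) -> w s t <= w 0 T.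
Proof.
move=> [/= s0 [st tT]]; have [_ wadd _ _] := w_control.
have sT := le_trans st tT; have t0 := le_trans s0 st.
have w1 : 0 <= w 0 s by apply: control_ge0.
have w2 : 0 <= w t T by apply: control_ge0.
have := wadd 0 s T (lexx _) s0 sT (lexx _).
by have := wadd s t T s0 st tT (lexx _); lra.
Qed.

Lemma near_diag_simplex s0 : \forall st \near near_diag s0, simplex T st.
Proof. exact: withinT. Qed.

Lemma near_diagP s0 (P : R -> R -> Prop) :
  (\forall st \near near_diag s0, P st.1 st.2) <->
  exists2 r, 0 < r & forall s t, 0 <= s -> s <= t -> t <= T ->
    `|s0 - s| < r -> `|s0 - t| < r -> P s t.
Proof.
split.
  move=> /nbhs_ballP[r r0 rP]; exists r => // s t s0' st tT s0s s0t.
  by apply: (rP (s, t)) => //; split; rewrite -ball_normE.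
move=> [r r0 rP]; apply/nbhs_ballP; exists r => //= -[s t] /= [].
by rewrite -ball_normE /= => s0s s0t [/= ? [? ?]]; exact: rP.
Qed.

(** From right to left: each [s0] has its own neighbourhood and constant, and
    compactness of [[0, T]] makes them uniform. *)
Lemma simeqP (V : normedModType R) (g h : R -> R -> V) :
  simeq T p w g h <-> forall s0, 0 <= s0 -> s0 <= T ->
    ctrlO s0 3 (fun s t => g s t - h s t).
Proof.
split.
  move=> [delta [C [delta0 ghC]]] s0 s00 s0T; exists C.
  apply/(near_diagP _ (fun s t => `|g s t - h s t| <= C * w s t `^ (3 / p))).
  exists (delta / 2); first by rewrite divr_gt0.
  move=> s t s_ge0 st tT; rewrite !ltr_norml => /andP[a1 a2] /andP[b1 b2].
  by apply: ghC => //; lra.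
move=> loc.
(* [n] stands both for the constant and for the inverse of the size of the
   neighbourhood of the diagonal, so that one parameter going to infinity
   makes both uniform. *)
pose P (n s : R) := forall t, 0 <= s -> s <= t -> t <= T -> t - s <= n^-1 ->
  `|g s t - h s t| <= n * w s t `^ (3 / p).
have : near_covering (`[0, T]%classic : set R).
  by apply/compact_near_coveringP; exact: segment_compact.
move=> /(_ R +oo_R P _) [] //.
  move=> s0 /=; rewrite in_itv /= => /andP[s00 s0T].
  have [C /(near_diagP _ (fun s t => `|g s t - h s t| <= C * w s t `^ (3 / p)))
    [r r0 rP]] := loc s0 s00 s0T.
  exists (ball s0 (r / 2), [set n | Num.max C (2 / r) < n]) => /=.
    split; first by apply: nbhsx_ballx; rewrite divr_gt0.
    by exists (Num.max C (2 / r)); split => //; exact: num_real.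
  move=> [s n] /= []; rewrite -ball_normE /= => s0s.
  rewrite gt_max => /andP[Cn rn] t s_ge0 st tT tsn.
  have n0 : 0 < n by rewrite (lt_trans _ rn) // divr_gt0.
  have nr : n^-1 < r / 2 by rewrite -invf_div ltf_pV2 ?posrE ?divr_gt0.
  apply: le_trans (rP s t s_ge0 st tT _ _) _.
  - by rewrite (lt_le_trans s0s) // ler_pdivrMr // ler_pMr // ler1n.
  - by move: s0s; rewrite !ltr_norml => /andP[? ?]; lra.
  - by rewrite ler_wpM2r ?powR_ge0 // ltW.
move=> n0 [_ n0P]; pose n := Num.max n0 0 + 1.
have nP : forall s, 0 <= s <= T -> P n s.
  move=> s s0T; apply: (n0P n); last by rewrite /= in_itv.
  by rewrite /= /n ltr_pwDr // le_max lexx.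
have n_gt0 : 0 < n by rewrite /n ltr_wpDl // le_max lexx orbT.
exists n^-1, n; split; first by rewrite invr_gt0.
move=> s t s0 st tT ts; apply: nP => //.
by rewrite s0 (le_trans st).
Qed.

Lemma powR_addn (x : R) (a b : nat) : 0 <= x ->
  x `^ (a%:R / p) * x `^ (b%:R / p) = x `^ ((a + b)%N%:R / p).
Proof.
move=> x0; have [->|xn0] := eqVneq x 0; last by rewrite natrD mulrDl powRD // xn0 implybT.
case: a => [|a]; first by rewrite mul0r powRr0 mul1r.
have cp (c : nat) : c.+1%:R / p != 0.
  by rewrite mulf_neq0 ?pnatr_eq0 ?invr_eq0 ?gt_eqF.
by rewrite addSn (powR0 (cp a)) (powR0 (cp _)) mul0r.
Qed.

Section at_fixed_time.
Variable s0 : R.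
Notation O := (ctrlO s0).

Lemma ctrlO_near (V : normedModType R) q (e e' : R -> R -> V) :
  (\forall st \near near_diag s0, e st.1 st.2 = e' st.1 st.2) ->
  O q e -> O q e'.
Proof. by move=> ee' [C eC]; exists C; apply: filterS2 ee' eC => st ->. Qed.

Lemma ctrlO_gt0 (V : normedModType R) q (e : R -> R -> V) : O q e ->
  exists2 C, 0 < C & \forall st \near near_diag s0,
    `|e st.1 st.2| <= C * w st.1 st.2 `^ (q%:R / p).
Proof.
move=> [C eC]; exists (`|C| + 1); first by rewrite ltr_wpDl.
apply: filterS eC => st /le_trans; apply; rewrite ler_wpM2r ?powR_ge0 //.
by rewrite (le_trans (ler_norm _)) // lerDl.
Qed.

(** Orders add up under products; every rule below for a particular product is
    an instance. *)
Lemma ctrlO_dom2 (V1 V2 V : normedModType R) q1 q2 (e1 : R -> R -> V1)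
    (e2 : R -> R -> V2) (e : R -> R -> V) K :
  (\forall st \near near_diag s0,
    `|e st.1 st.2| <= K * `|e1 st.1 st.2| * `|e2 st.1 st.2|) ->
  O q1 e1 -> O q2 e2 -> O (q1 + q2) e.
Proof.
move=> eK /ctrlO_gt0[C1 C10 e1C] /ctrlO_gt0[C2 C20 e2C]; exists (`|K| * C1 * C2).
apply: filterS3 (filterI eK (near_diag_simplex s0)) e1C e2C.
move=> [s t] /= [eK' st] le1 le2.
rewrite -powR_addn; last exact: control_ge0.
apply: le_trans eK' _; apply: (@le_trans _ _ (`|K| * (`|e1 s t| * `|e2 s t|))).
  by rewrite -mulrA ler_wpM2r ?mulr_ge0 // ler_norm.
rewrite -!mulrA ler_wpM2l // [C2 * _]mulrCA [leRHS]mulrA.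
by rewrite ler_pM.
Qed.

Lemma ctrlO_dom (V1 V : normedModType R) q (e1 : R -> R -> V1)
    (e : R -> R -> V) K :
  (\forall st \near near_diag s0,
    `|e st.1 st.2| <= K * `|e1 st.1 st.2|) -> O q e1 -> O q e.
Proof.
move=> eK /ctrlO_gt0[C1 C10 e1C]; exists (`|K| * C1).
apply: filterS2 eK e1C => -[s t] /= eK' le1.
apply: le_trans eK' _; apply: (@le_trans _ _ (`|K| * `|e1 s t|)).
  by rewrite ler_wpM2r // ler_norm.
by rewrite -mulrA ler_wpM2l.
Qed.

Lemma ctrlO_bounded (V : normedModType R) (e : R -> R -> V) K :
  (\forall st \near near_diag s0, `|e st.1 st.2| <= K) -> O 0 e.
Proof.
move=> eK; exists K; apply: filterS eK => st.
by rewrite mul0r powRr0 mulr1.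
Qed.

Lemma ctrlO0 (V : normedModType R) q : O q (fun _ _ => 0 : V).
Proof. by exists 0; near=> st; rewrite normr0 mul0r. Unshelve. all: by end_near. Qed.

Lemma ctrlOD (V : normedModType R) q (e e' : R -> R -> V) :
  O q e -> O q e' -> O q (fun s t => e s t + e' s t).
Proof.
move=> [C eC] [C' eC']; exists (C + C'); apply: filterS2 eC eC' => st h h'.
by rewrite (le_trans (ler_normD _ _)) // mulrDl lerD.
Qed.

Lemma ctrlON (V : normedModType R) q (e : R -> R -> V) :
  O q e -> O q (fun s t => - e s t).
Proof. by move=> [C eC]; exists C; apply: filterS eC => st; rewrite normrN. Qed.

Lemma ctrlOB (V : normedModType R) q (e e' : R -> R -> V) :
  O q e -> O q e' -> O q (fun s t => e s t - e' s t).
Proof. by move=> Oe Oe'; apply: ctrlOD => //; exact: ctrlON. Qed.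

Lemma ctrlO_sum (V : normedModType R) q (I : Type) (r : seq I)
    (e : I -> R -> R -> V) :
  (forall i, O q (e i)) -> O q (fun s t => \sum_(i <- r) e i s t).
Proof.
move=> Oe; elim: r => [|i r ih].
  by apply: ctrlO_near (ctrlO0 V q); near=> st; rewrite big_nil.
apply: ctrlO_near (ctrlOD (Oe i) ih); near=> st; by rewrite big_cons.
Unshelve. all: by end_near. Qed.

Lemma ctrlO_bilin (V1 V2 V : normedModType R) (b : {bilinear V1 -> V2 -> V})
    q1 q2 (e1 : R -> R -> V1) (e2 : R -> R -> V2) :
  continuous (fun p => b p.1 p.2) ->
  O q1 e1 -> O q2 e2 -> O (q1 + q2) (fun s t => b (e1 s t) (e2 s t)).
Proof.
move=> /bilinear_schwarz[K _ bK] O1 O2; apply: (ctrlO_dom2 (K := K)) O1 O2.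
by near=> st; exact: bK.
Unshelve. all: by end_near. Qed.

Lemma ctrlO_mulmx m n k q1 q2 (A : R -> R -> 'M[R]_(m, n)) (B : R -> R -> 'M[R]_(n, k)) :
  O q1 A -> O q2 B -> O (q1 + q2) (fun s t => A s t *m B s t).
Proof. by apply: ctrlO_bilin; exact: mulmx_continuous. Qed.

Lemma ctrlOZ (V : normedModType R) q1 q2 (a : R -> R -> R) (e : R -> R -> V) :
  O q1 a -> O q2 e -> O (q1 + q2) (fun s t => a s t *: e s t).
Proof. by apply: ctrlO_bilin; exact: scale_continuous. Qed.

Lemma ctrlO_entry m n q (A : R -> R -> 'M[R]_(m, n)) i j :
  O q A -> O q (fun s t => A s t i j).
Proof.
apply: (ctrlO_dom (K := 1)); near=> st; rewrite mul1r; exact: mx_entry_le.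
Unshelve. all: by end_near. Qed.

Lemma ctrlO_tr m n q (A : R -> R -> 'M[R]_(m, n)) :
  O q A -> O q (fun s t => (A s t)^T).
Proof.
apply: (ctrlO_dom (K := 1)); near=> st; rewrite mul1r.
by apply: mx_norm_le => // i j; rewrite mxE mx_entry_le.
Unshelve. all: by end_near. Qed.

(** The control is bounded on the simplex, so extra powers of it may be
    dropped. *)
Lemma ctrlO_weak (V : normedModType R) q1 q2 (e : R -> R -> V) :
  (q1 <= q2)%N -> O q2 e -> O q1 e.
Proof.
move=> q12 /ctrlO_gt0[C C0 eC]; exists (C * w 0 T `^ ((q2 - q1)%N%:R / p)).
apply: filterS2 eC (near_diag_simplex s0) => -[s t] /= eC st.
have w0 := control_ge0 st.
apply: le_trans eC _; rewrite -[q2 in leLHS](subnK q12) -powR_addn //.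
rewrite mulrA ler_wpM2r ?powR_ge0 // ler_wpM2l ?(ltW C0) //.
rewrite ge0_ler_powR ?nnegrE ?divr_ge0 ?(ltW p_gt0) ?control_le //.
by apply: control_ge0; split => /=; rewrite ?lexx ?ltW.
Qed.

End at_fixed_time.

Section rough_paths.
Variables (k : nat) (X : rpath R k).
Hypothesis X_rough : WG T p w X.

Lemma WG_level1 s0 : ctrlO s0 1 (level1 X).
Proof.
have [_ [_ [_ [[C XC] _]]]] := X_rough; exists C.
apply: filterS (near_diag_simplex s0) => -[s t] [/= s_ge0 [st tT]].
have [<-|sn] := eqVneq s t; last by apply: XC => //; rewrite lt_neqAle sn.
have [_ _ w0 _] := w_control.
rewrite /level1 subrr normr0 w0 //; last exact: le_trans st tT.
by rewrite powR0 ?mulr0 // mul1r invr_eq0 gt_eqF.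
Qed.

Lemma WG_level2 s0 : ctrlO s0 2 (level2 X).
Proof.
have [_ [_ [chen [_ [[C XC] _]]]]] := X_rough; exists C.
apply: filterS (near_diag_simplex s0) => -[s t] [/= s_ge0 [st tT]].
have [E|sn] := eqVneq s t; last by apply: XC => //; rewrite lt_neqAle sn.
have [_ _ w0 _] := w_control; rewrite -{}E in tT *.
have := chen s s s s_ge0 (lexx _) (lexx _) tT.
rewrite /level1 subrr /tens mulmx0 addr0 => /eqP.
rewrite addrC -subr_eq subrr eq_sym => /eqP ->.
by rewrite normr0 w0 // powR0 ?mulr0 // mulf_neq0 // invr_eq0 gt_eqF.
Qed.

Lemma WG_trace s0 (U : set 'rV[R]_k) : 0 <= s0 -> s0 <= T -> nbhs (X.1 s0) U ->
  \forall st \near near_diag s0, U (X.1 st.1) /\ U (X.1 st.2).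
Proof.
move=> s00 s0T nU; have [cX _] := X_rough.
have : within `[0, T]%classic (nbhs s0) (X.1 @^-1` U).
  move/subspace_continuousP : cX => /(_ s0); apply => //=.
  by rewrite in_itv /= s00.
move=> /nbhs_ballP[r r0 rP]; apply/(near_diagP _ (fun s t => U (X.1 s) /\ U (X.1 t))).
exists r => // s t s_ge0 st tT s0s s0t; split; apply: rP; rewrite -?ball_normE //=.
  by rewrite in_itv /= s_ge0 (le_trans st).
by rewrite in_itv /= tT (le_trans s_ge0).
Qed.

Lemma ctrlO_trace (V : normedModType R) s0 (g : 'rV[R]_k -> V) :
  0 <= s0 -> s0 <= T -> {for X.1 s0, continuous g} ->
  ctrlO s0 0 (fun s t => g (X.1 s)).
Proof.
move=> s00 s0T /continuous_near_bounded[K K0 gK]; apply: (ctrlO_bounded (K := K)).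
by have := WG_trace s00 s0T gK; apply: filterS => st [].
Qed.

Lemma WG_symmetric s t : 0 <= s -> s <= t -> t <= T ->
  level2 X s t + (level2 X s t)^T = tens (level1 X s t) (level1 X s t).
Proof.
move=> s_ge0 st tT; have [_ [_ [_ [_ [_ sym]]]]] := X_rough.
by apply: (scalerI _ (sym s t s_ge0 st tT)); rewrite invr_eq0 pnatr_eq0.
Qed.

End rough_paths.

End orders.

(** * Contracting a bilinear map with a tensor *)

Section bilin_forms.
Variable R : realType.

Definition bilinear_map k (V : lmodType R) (B : 'rV[R]_k -> 'rV[R]_k -> V) :=
  (forall b, linear (B^~ b)) /\ (forall a, linear (B a)).

Lemma linear_row_sum k (V : lmodType R) (f : 'rV[R]_k -> V) u : linear f ->
  f u = \sum_i u 0 i *: f (delta_mx 0 i).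
Proof.
move=> lf; pose fM := GRing.isLinear.Build _ _ _ _ _ lf.
pose fL : {linear _ -> _} := HB.pack f fM.
rewrite -[f]/(fL : _ -> _) [in LHS](row_sum_delta u) linear_sum.
by apply: eq_bigr => i _; rewrite linearZ.
Qed.

Lemma bilin_tens k (V : lmodType R) (B : 'rV[R]_k -> 'rV[R]_k -> V) u v :
  bilinear_map B -> bilin B (tens u v) = B u v.
Proof.
move=> [Bl Br]; rewrite (linear_row_sum u (Bl v)); apply: eq_bigr => i _.
rewrite (linear_row_sum v (Br _)) scaler_sumr; apply: eq_bigr => j _.
by rewrite scalerA /tens mxE big_ord1 mxE.
Qed.

Lemma bilin_is_linear k (V : lmodType R) (B : 'rV[R]_k -> 'rV[R]_k -> V) :
  linear (bilin B).
Proof.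
move=> c A A'; rewrite /bilin scaler_sumr -big_split; apply: eq_bigr => i _ /=.
rewrite scaler_sumr -big_split; apply: eq_bigr => j _ /=.
by rewrite !mxE scalerDl scalerA.
Qed.

HB.instance Definition _ k (V : lmodType R) (B : 'rV[R]_k -> 'rV[R]_k -> V) :=
  GRing.isLinear.Build R 'M[R]_k V *:%R (bilin B) (bilin_is_linear B).

Lemma bilinB k (V : lmodType R) (B : 'rV[R]_k -> 'rV[R]_k -> V) A A' :
  bilin B (A - A') = bilin B A - bilin B A'.
Proof. exact: linearB. Qed.

Lemma eq_bilin k (V : lmodType R) (B B' : 'rV[R]_k -> 'rV[R]_k -> V) A :
  (forall i j, B (delta_mx 0 i) (delta_mx 0 j) = B' (delta_mx 0 i) (delta_mx 0 j)) ->
  bilin B A = bilin B' A.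
Proof.
by move=> BB'; apply: eq_bigr => i _; apply: eq_bigr => j _; rewrite BB'.
Qed.

Lemma bilin_add k (V : lmodType R) (B B' : 'rV[R]_k -> 'rV[R]_k -> V) A :
  bilin (fun a b => B a b + B' a b) A = bilin B A + bilin B' A.
Proof.
rewrite /bilin -big_split; apply: eq_bigr => i _ /=.
by rewrite -big_split; apply: eq_bigr => j _ /=; rewrite scalerDr.
Qed.

Lemma bilin_bilin_tens n k (V : lmodType R) (B : 'rV[R]_k -> 'rV[R]_k -> V)
    (y : 'rV[R]_n -> 'rV[R]_k) A :
  bilinear_map B -> bilin B (bilin (fun a b => tens (y a) (y b)) A) =
  bilin (fun a b => B (y a) (y b)) A.
Proof.
move=> Bb; rewrite {2}/bilin linear_sum; apply: eq_bigr => i _.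
rewrite linear_sum; apply: eq_bigr => j _.
by rewrite linearZ /= bilin_tens.
Qed.

Lemma bilin_mulmx n k q (B : 'rV[R]_n -> 'rV[R]_n -> 'rV[R]_k) (A : 'M[R]_(k, q)) Z :
  bilin (fun a b => B a b *m A) Z = bilin B Z *m A.
Proof.
rewrite /bilin mulmx_suml; apply: eq_bigr => i _.
by rewrite mulmx_suml; apply: eq_bigr => j _; rewrite scalemxAl.
Qed.

Lemma derive_linear N (W : normedModType R) (f : 'rV[R]_N -> W) x :
  differentiable f x -> linear (fun a => 'D_a f x).
Proof. by move=> df c a b; rewrite !deriveE // linearP. Qed.

Lemma bilinear_map_derive N k (A : 'rV[R]_N -> 'M[R]_(N, k)) x :
  differentiable A x -> bilinear_map (fun a b => b *m 'D_a A x).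
Proof.
move=> dA; split=> [b c a a'|a c b b'] /=.
  by rewrite (derive_linear dA) mulmxDr -scalemxAr.
by rewrite mulmxDl -scalemxAl.
Qed.

Lemma bilinear_map_tens N k (f : 'rV[R]_N -> 'rV[R]_k) :
  linear f -> bilinear_map (fun a b => tens (f a) (f b)).
Proof.
move=> lf; split=> [b c a a'|a c b b']; rewrite /tens lf.
  by rewrite linearP /= mulmxDl -scalemxAl.
by rewrite mulmxDr -scalemxAr.
Qed.

Lemma bilin_tr k (V : lmodType R) (B : 'rV[R]_k -> 'rV[R]_k -> V) A :
  bilin B A^T = bilin (fun a b => B b a) A.
Proof.
rewrite /bilin exchange_big; apply: eq_bigr => i _; apply: eq_bigr => j _.
by rewrite mxE.
Qed.

Lemma bilin_tens_mulmx k q (P : 'M[R]_(k, q)) (A : 'M[R]_k) :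
  bilin (fun a b => tens (a *m P) (b *m P)) A = P^T *m A *m P.
Proof.
rewrite [in RHS](matrix_sum_delta A) mulmx_sumr mulmx_suml; apply: eq_bigr => i _.
rewrite mulmx_sumr mulmx_suml; apply: eq_bigr => j _.
rewrite -scalemxAr -scalemxAl /tens trmx_mul trmx_delta -!mulmxA.
by congr (_ *: (_ *m _)); rewrite !mulmxA mul_delta_mx.
Qed.

Lemma row_norm_le m n (A : 'M[R]_(m, n)) i : `|row i A| <= `|A|.
Proof. by apply: mx_norm_le => // a b; rewrite mxE mx_entry_le. Qed.

Lemma mx_norm_row_le m n (A : 'M[R]_(m, n)) (K : R) :
  0 <= K -> (forall i, `|row i A| <= K) -> `|A| <= K.
Proof.
move=> K0 AK; apply: mx_norm_le => // i j; apply: le_trans (AK i).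
by have := mx_entry_le (row i A) 0 j; rewrite mxE.
Qed.

(** The direction [b] stays fixed while the base point moves, and ['D_b g] is
    [b] times the Jacobian. *)
Lemma derive2_jacobian N k (U : set 'rV[R]_N) (g : 'rV[R]_N -> 'rV[R]_k) x a b :
  open U -> smooth_on U g -> U x ->
  'D_a ('D_b g) x = b *m 'D_a (jacobian g) x.
Proof.
move=> oU sg Ux.
have -> : 'D_a ('D_b g) x = 'D_a (fun y => b *m jacobian g y) x.
  apply: near_eq_derive; apply: (open_eq_near oU) Ux => y Uy.
  by rewrite deriveEjacobian //; exact: smooth_on_differentiable Uy.
rewrite (@derive_mulmx _ _ _ _ _ (fun=> b) (jacobian g)).
- by rewrite derive_cst mul0mx add0r.
- exact: differentiable_cst.
- exact: smooth_on_differentiable (smooth_on_jacobian oU sg) Ux.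
Qed.

(** [A] may replace half of [tens h h]: the two have the same symmetric part,
    and the second derivative of [g] is a symmetric form. *)
Lemma hessian_form N k (U : set 'rV[R]_N) (g : 'rV[R]_N -> 'rV[R]_k) x h A :
  open U -> smooth_on U g -> U x -> A + A^T = tens h h ->
  2^-1 *: 'D_h ('D_h g) x = bilin (fun a b => b *m 'D_a (jacobian g) x) A.
Proof.
move=> oU sg Ux Ah.
have dJ := smooth_on_differentiable (smooth_on_jacobian oU sg) Ux.
rewrite (derive2_jacobian _ _ oU sg Ux).
pose B (a b : 'rV[R]_N) : 'rV[R]_k := b *m 'D_a (jacobian g) x.
have Bb : bilinear_map B by exact: bilinear_map_derive.
have Bs i j : B (delta_mx 0 i) (delta_mx 0 j) = B (delta_mx 0 j) (delta_mx 0 i).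
  rewrite /B -(derive2_jacobian (delta_mx 0 i) (delta_mx 0 j) oU sg Ux).
  rewrite -(derive2_jacobian (delta_mx 0 j) (delta_mx 0 i) oU sg Ux).
  exact: (schwarz_mx _ _ oU sg Ux).
rewrite -[h *m _]/(B h h) -[bilin _ A]/(bilin B A).
move: B Bb Bs => B Bb Bs.
rewrite -bilin_tens // -Ah linearD /= bilin_tr.
rewrite -(@eq_bilin _ _ B (fun a b => B b a) A Bs).
by rewrite -mulr2n -[bilin B A *+ 2]scaler_nat scalerA mulVf ?scale1r // pnatr_eq0.
Qed.

End bilin_forms.

Section manifold_derivatives.
Variables (R : realType) (N d : nat) (M : set 'rV[R]_N).

Lemma mderive_ext (W : normedModType R) (f g : 'rV[R]_N -> W) m v :
  (forall y, M y -> f y = g y) -> mderive M f m v = mderive M g m v.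
Proof.
move=> fg; rewrite /mderive; congr get.
apply/seteqP; split=> y [U [h [[oU Um sh hf] ->]]];
  exists U, h; split=> //; split=> // z Uz Mz; rewrite hf // fg //.
Qed.

Lemma mderive_id m v : M m -> tau d M m v -> mderive M (@id 'rV[R]_N) m v = v.
Proof.
move=> Mm tv; rewrite (@mderiveE R N d _ M id m setT id v) ?derive_id //.
by split=> //; [exact: openT|exact: smooth_on_id].
Qed.

(** The Leibniz rule for [Y2 A], in terms of a local extension of [Y2].  The
    function [phi] is only compared with [Y2 A] on [M], where the derivative
    along a tangent vector is determined. *)
Lemma lie_mulmx k (Y1 Y2 : 'rV[R]_N -> 'rV[R]_N) (phi : 'rV[R]_N -> 'rV[R]_k)
    (U : set 'rV[R]_N) (A : 'rV[R]_N -> 'M[R]_(N, k)) m :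
  M m -> tau d M m (Y1 m) -> smooth_on_mfd M Y2 -> open U -> smooth_on U A ->
  U m -> (forall y, U y -> M y -> phi y = Y2 y *m A y) ->
  lie M Y1 phi m = lie M Y1 Y2 m *m A m + Y2 m *m 'D_(Y1 m) A m.
Proof.
move=> Mm tY1 sY2 oU sA Um phiE; have [U2 [g eg]] := sY2 m Mm.
have [oU2 U2m sg gE] := eg.
have dA := smooth_on_differentiable sA Um.
have dg := smooth_on_differentiable sg U2m.
have oI : open (U `&` U2) by exact: openI.
rewrite /lie (mderiveE eg Mm tY1).
rewrite (@mderiveE R N d _ M phi m (U `&` U2) (fun y => g y *m A y) (Y1 m)) //; last first.
  split=> // [|y [Uy U2y] My]; last by rewrite phiE // gE.
  apply: smooth_on_mulmx => //.
    by apply: smooth_on_sub sg => y [].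
  by apply: smooth_on_sub sA => y [].
by rewrite derive_mulmx // gE.
Qed.

End manifold_derivatives.

(** * The three characterisations of a solution *)

Section equivalence.
Variables (R : realType) (T p : R) (w : R -> R -> R) (N d n : nat).
Variables (M : set 'rV[R]_N) (Y : 'rV[R]_n -> 'rV[R]_N -> 'rV[R]_N).
Variables (Z : rpath R n) (X : rpath R N) (x0 : 'rV[R]_N).
Hypotheses (T_gt0 : 0 < T) (p_gt0 : 0 < p) (w_control : control T w).
Hypothesis M_submanifold : embedded_submanifold d M.
Hypothesis Y_field : forall a, vector_field d M (Y a).
Hypothesis X_rough : WGM T p w d M X.

Notation O := (ctrlO T p w).

Let X_WG : WG T p w X. Proof. by have [] := X_rough. Qed.
Let X_M t : 0 <= t -> t <= T -> M (X.1 t). Proof. by have [] := X_rough; auto. Qed.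

Lemma near_trace_mfd s0 U : 0 <= s0 -> s0 <= T -> open U -> U (X.1 s0) ->
  \forall st \near near_diag T s0, [/\ simplex T st, M (X.1 st.1), M (X.1 st.2),
    U (X.1 st.1) & U (X.1 st.2)].
Proof.
move=> s00 s0T oU Us0.
apply: filterS2 (near_diag_simplex T s0)
  (WG_trace X_WG s00 s0T (open_nbhs_nbhs (conj oU Us0))).
move=> [s t] [/= s_ge0 [st tT]] [Us Ut]; split => //; apply: X_M => //.
  exact: le_trans tT.
exact: le_trans st.
Qed.

Lemma ctrlO_bilin_form (V : normedModType R) s0 q
    (B : R -> 'rV[R]_N -> 'rV[R]_N -> V) (E : R -> R -> 'M[R]_N) :
  (forall i j, O s0 0 (fun s t => B s (delta_mx 0 i) (delta_mx 0 j))) ->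
  O s0 q E -> O s0 q (fun s t => bilin (B s) (E s t)).
Proof.
move=> OB OE; apply: ctrlO_sum => i; apply: ctrlO_sum => j.
by rewrite -[q]addn0; apply: ctrlOZ => //; exact: ctrlO_entry.
Qed.

Lemma ctrlO_derive_form k s0 U (A : 'rV[R]_N -> 'M[R]_(N, k)) i j :
  0 <= s0 -> s0 <= T -> open U -> smooth_on U A -> U (X.1 s0) ->
  O s0 0 (fun s t => (delta_mx 0 j : 'rV[R]_N) *m 'D_(delta_mx 0 i) A (X.1 s)).
Proof.
move=> s00 s0T oU sA Us0.
pose g (x : 'rV[R]_N) := (delta_mx 0 j : 'rV[R]_N) *m 'D_(delta_mx 0 i) A x.
have sg : smooth_on U g.
  apply: smooth_on_mulmx => //; first exact: smooth_on_cst.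
  exact: smooth_on_derive.
exact: (ctrlO_trace X_WG s00 s0T (smooth_on_continuous sg Us0)).
Qed.

(** The Taylor remainder has order three in the increment; the quadratic term is
    rewritten with the second level by [hessian_form]. *)
Lemma taylor_path k s0 U (g : 'rV[R]_N -> 'rV[R]_k) :
  0 <= s0 -> s0 <= T -> open U -> smooth_on U g -> U (X.1 s0) ->
  O s0 3 (fun s t => g (X.1 t) - g (X.1 s) - (level1 X s t *m jacobian g (X.1 s) +
    bilin (fun a b => b *m 'D_a (jacobian g) (X.1 s)) (level2 X s t))).
Proof.
move=> s00 s0T oU sg Us0.
have [C C0 [r r0 rC]] := taylor3_mx oU sg Us0.
have O1 := WG_level1 p_gt0 w_control X_WG s0.
have O2 : O s0 2 (fun s t => `|level1 X s t| ^+ 2).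
  apply: (ctrlO_dom2 p_gt0 w_control (K := 1)) (O1) (O1).
  by near=> st; rewrite mul1r ger0_norm ?exprn_ge0 // expr2.
apply: (ctrlO_dom2 p_gt0 w_control (K := C)) O1 O2.
have nb := WG_trace X_WG s00 s0T (nbhsx_ballx (X.1 s0) r r0).
apply: filterS2 nb (near_trace_mfd s00 s0T oU Us0).
move=> [s t] /= []; rewrite -!ball_normE /= => bs bt [[/= s_ge0 [st tT]] _ _ Us _].
have := rC _ _ bs bt; rewrite -[X.1 t - X.1 s]/(level1 X s t) => le.
have sym := WG_symmetric X_WG s_ge0 st tT.
rewrite -(hessian_form oU sg Us sym) -deriveEjacobian; last first.
  exact: smooth_on_differentiable Us.
rewrite opprD addrA [in leRHS]ger0_norm ?exprn_ge0 // -mulrA -exprS.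
exact: le.
Unshelve. all: by end_near. Qed.

Section solution.
Hypothesis X_solves : solves_RDE T p w M Y Z x0 X.

(** The error of the second-level expansion enters linearly, against bounded
    coefficients; [bilin_bilin_tens] evaluates the main term. *)
Lemma solution_form (V : normedModType R) s0 (B : R -> 'rV[R]_N -> 'rV[R]_N -> V) :
  0 <= s0 -> s0 <= T ->
  (\forall st \near near_diag T s0, bilinear_map (B st.1)) ->
  (forall i j, O s0 0 (fun s t => B s (delta_mx 0 i) (delta_mx 0 j))) ->
  O s0 3 (fun s t => bilin (B s) (level2 X s t) -
    bilin (fun a b => B s (Y a (X.1 s)) (Y b (X.1 s))) (level2 Z s t)).
Proof.
move=> s00 s0T Bb OB; have [_ _ /simeqP] := X_solves.
move=> /(_ _ s00 s0T) OE.
apply: ctrlO_near (ctrlO_bilin_form OB OE); apply: filterS Bb => -[s t] /= Bs.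
by rewrite bilinB bilin_bilin_tens.
Qed.

(** Both expansions of the solution are inserted; the error of the first is
    multiplied by [A], that of the second by the derivative of [A], and both
    factors are bounded. *)
Lemma solution_one_form k s0 U (A : 'rV[R]_N -> 'M[R]_(N, k)) :
  0 <= s0 -> s0 <= T -> open U -> smooth_on U A -> U (X.1 s0) ->
  O s0 3 (fun s t => level1 X s t *m A (X.1 s) +
      bilin (fun a b => b *m 'D_a A (X.1 s)) (level2 X s t) -
    (Y (level1 Z s t) (X.1 s) *m A (X.1 s) +
     bilin (fun a b => lie M (Y a) (Y b) (X.1 s) *m A (X.1 s) +
       Y b (X.1 s) *m 'D_(Y a (X.1 s)) A (X.1 s)) (level2 Z s t))).
Proof.
move=> s00 s0T oU sA Us0; have [_ /simeqP OX _] := X_solves.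
have {OX} O1 := OX _ s00 s0T.
have OA : O s0 0 (fun s t => A (X.1 s)).
  by apply: ctrlO_trace => //; exact: smooth_on_continuous Us0.
have O2 : O s0 3 _ := ctrlO_mulmx p_gt0 w_control O1 OA.
have Bb : \forall st \near near_diag T s0,
    bilinear_map (fun a b => b *m 'D_a A (X.1 st.1)).
  apply: filterS (near_trace_mfd s00 s0T oU Us0) => st [_ _ _ Us _].
  by apply: bilinear_map_derive; exact: smooth_on_differentiable Us.
have O3 := @solution_form _ s0 (fun s a b => b *m 'D_a A (X.1 s)) s00 s0T Bb
  (fun i j => ctrlO_derive_form i j s00 s0T oU sA Us0).
apply: ctrlO_near (ctrlOD O2 O3); near=> st.
rewrite bilin_add bilin_mulmx mulmxBl addrACA -opprD !mulmxDl.
by rewrite !opprD !addrA.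
Unshelve. all: by end_near. Qed.

Lemma solution_rough_integral k (al : 'rV[R]_N -> 'rV[R]_N -> 'rV[R]_k)
    (V : rpath R k) : is_rough_integral_mfd T p w d M al X V ->
  simeq T p w (level1 V) (fun s t =>
    al (X.1 s) (Y (level1 Z s t) (X.1 s)) +
    bilin (fun a b => lie M (Y a) (fun m => al m (Y b m)) (X.1 s)) (level2 Z s t))
  /\
  simeq T p w (level2 V) (fun s t =>
    bilin (fun a b => tens (al (X.1 s) (Y a (X.1 s))) (al (X.1 s) (Y b (X.1 s))))
      (level2 Z s t)).
Proof.
move=> [U [A [MU [oU sA alE] [_ _ V1 V2]]]].
have Us0 s0 : 0 <= s0 -> s0 <= T -> U (X.1 s0) by move=> *; apply/MU/X_M.
split; apply/simeqP => s0 s00 s0T.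
  have O1 := iffLR (simeqP _ _ _ _ _) V1 s0 s00 s0T.
  have O2 := solution_one_form s00 s0T oU sA (Us0 _ s00 s0T).
  apply: ctrlO_near (ctrlOD O1 O2).
  apply: filterS (near_trace_mfd s00 s0T oU (Us0 _ s00 s0T)).
  move=> [s t] /= [_ Ms _ Us _]; rewrite subrKA; congr (_ - _).
  have tY a : tau d M (X.1 s) (Y a (X.1 s)) by apply: (Y_field a).2.
  rewrite alE //; congr (_ + _); apply: eq_bilin => i j.
  rewrite -(lie_mulmx (phi := fun m => al m (Y 'e_j m))
    Ms (tY _) (Y_field _).1 oU sA Us) //.
  by move=> y Uy My; rewrite alE //; apply: (Y_field _).2.
have O1 := iffLR (simeqP _ _ _ _ _) V2 s0 s00 s0T.
pose B s a b := tens (a *m A (X.1 s)) (b *m A (X.1 s)).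
have OA : O s0 0 (fun s t => A (X.1 s)).
  exact: (ctrlO_trace X_WG s00 s0T (smooth_on_continuous sA (Us0 _ s00 s0T))).
have OB i j : O s0 0 (fun s t => B s 'e_i 'e_j).
  have Oe (l : 'I_N) : O s0 0 (fun s t => ('e_l : 'rV[R]_N) *m A (X.1 s)).
    apply: (ctrlO_mulmx p_gt0 w_control (q1 := 0)) OA.
    apply: (@ctrlO_bounded R T p w s0 _ _ (`|delta_mx 0 l : 'rV[R]_N|)).
    by apply: nearW => st; exact: lexx.
  exact: (ctrlO_mulmx p_gt0 w_control (ctrlO_tr (Oe i)) (Oe j)).
have Bb s : bilinear_map (B s).
  by apply: bilinear_map_tens => c a b; rewrite mulmxDl -scalemxAl.
have Bn : \forall st \near near_diag T s0, bilinear_map (B st.1) by near=> st.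
have O2 := solution_form s00 s0T Bn OB.
apply: ctrlO_near (ctrlOD O1 O2).
apply: filterS (near_trace_mfd s00 s0T oU (Us0 _ s00 s0T)).
move=> [s t] /= [_ Ms _ Us _]; rewrite subrKA; congr (_ - _).
apply: eq_bilin => i j; rewrite /B !alE //; exact: (Y_field _).2.
Unshelve. all: by end_near. Qed.

Lemma solution_function k (f : 'rV[R]_N -> 'rV[R]_k) : smooth_on_mfd M f ->
  simeq T p w (fun s t => f (X.1 t) - f (X.1 s)) (fun s t =>
    lie M (Y (level1 Z s t)) f (X.1 s) +
    bilin (fun a b => lie M (Y a) (lie M (Y b) f) (X.1 s)) (level2 Z s t))
  /\
  simeq T p w
    (fun s t => bilin (fun a b =>
      tens (mderive M f (X.1 s) (tproj d M (X.1 s) a))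
           (mderive M f (X.1 s) (tproj d M (X.1 s) b))) (level2 X s t))
    (fun s t => bilin (fun a b =>
      tens (lie M (Y a) f (X.1 s)) (lie M (Y b) f (X.1 s))) (level2 Z s t)).
Proof.
move=> sf; split; apply/simeqP => s0 s00 s0T;
  have [U [g eg]] := sf _ (X_M s00 s0T); have [oU Us0 sg gE] := eg;
  have sJ := smooth_on_jacobian oU sg.
  have O1 := taylor_path s00 s0T oU sg Us0.
  have O2 := solution_one_form s00 s0T oU sJ Us0.
  apply: ctrlO_near (ctrlOD O1 O2).
  apply: filterS (near_trace_mfd s00 s0T oU Us0).
  move=> [s t] /= [_ Ms Mt Us Ut]; rewrite subrKA !gE //; congr (_ - _).
  have tY a : tau d M (X.1 s) (Y a (X.1 s)) by apply: (Y_field a).2.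
  have lieE y a : U y -> M y -> lie M (Y a) f y = Y a y *m jacobian g y.
    move=> Uy My; rewrite /lie (mderiveE (d := d) (local_extension_sub eg Uy) My).
      by rewrite deriveEjacobian //; exact: smooth_on_differentiable Uy.
    exact: (Y_field a).2.
  rewrite lieE //; congr (_ + _); apply: eq_bilin => i j.
  rewrite -(lie_mulmx (phi := lie M (Y 'e_j) f) Ms (tY _) (Y_field _).1 oU sJ Us) //.
  by move=> y Uy My; rewrite lieE.
pose P s := tproj d M (X.1 s).
pose B s a b :=
  tens (P s a *m jacobian g (X.1 s)) (P s b *m jacobian g (X.1 s)).
have dfE s v : U (X.1 s) -> M (X.1 s) -> tau d M (X.1 s) v ->
    mderive M f (X.1 s) v = v *m jacobian g (X.1 s).
  move=> Us Ms tv; rewrite (mderiveE (local_extension_sub eg Us) Ms tv).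
  by rewrite deriveEjacobian //; exact: smooth_on_differentiable Us.
have OJ : O s0 0 (fun s t => jacobian g (X.1 s)).
  exact: (ctrlO_trace X_WG s00 s0T (smooth_on_continuous sJ Us0)).
have nU := near_trace_mfd s00 s0T oU Us0.
have OB i j : O s0 0 (fun s t => B s 'e_i 'e_j).
  have Oe (l : 'I_N) : O s0 0 (fun s t => P s 'e_l *m jacobian g (X.1 s)).
    apply: (ctrlO_mulmx p_gt0 w_control (q1 := 0)) OJ.
    apply: (@ctrlO_bounded R T p w s0 _ _ (N%:R * `|'e_l : 'rV[R]_N|)).
    by apply: filterS nU => st [_ Ms _ _ _]; exact: tproj_norm.
  exact: (ctrlO_mulmx p_gt0 w_control (ctrlO_tr (Oe i)) (Oe j)).
have Bn : \forall st \near near_diag T s0, bilinear_map (B st.1).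
  apply: filterS nU => st [_ Ms _ _ _].
  apply: (bilinear_map_tens (f := fun a => P st.1 a *m _)).
  by move=> c a b; rewrite /P tproj_lin // mulmxDl -scalemxAl.
have O2 := solution_form s00 s0T Bn OB.
apply: ctrlO_near O2; apply: filterS nU => -[s t] /= [_ Ms _ Us _].
congr (_ - _); apply: eq_bilin => i j; rewrite /B /P.
  by rewrite !dfE //; apply: (tproj_spec _ _ Ms).1.
have tY a : tau d M (X.1 s) (Y a (X.1 s)) by apply: (Y_field a).2.
by rewrite !tproj_id // /lie !dfE.
Qed.

End solution.

(** With [A], the forms [x_i A] vanish on [TM].  Since
    [(x_i A)'[a (x) b] = a_i A b + x_i A'[a (x) b]], the vanishing expansions of
    [A] and of [x_i A] combine to [row i X_{s,t} *m A = O(w^(3/p))]; then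
    [x_{s,t} *m A] is at most of the order of the second level. *)
Lemma conormal_order k (A : 'rV[R]_N -> 'M[R]_(N, k)) s0 :
  0 <= s0 -> s0 <= T -> smooth_on setT A ->
  (forall m v, M m -> tau d M m v -> v *m A m = 0) ->
  O s0 2 (fun s t => level1 X s t *m A (X.1 s)) /\
  O s0 3 (fun s t => level2 X s t *m A (X.1 s)).
Proof.
move=> s00 s0T sA A0; have [_ _ int0] := X_rough.
have vanish (B : 'rV[R]_N -> 'M[R]_(N, k)) : smooth_on setT B ->
    (forall m v, M m -> tau d M m v -> v *m B m = 0) ->
    O s0 3 (fun s t => level1 X s t *m B (X.1 s) +
      bilin (fun a b => b *m 'D_a B (X.1 s)) (level2 X s t)).
  move=> sB B0; have [_ _ V1 _] := int0 _ _ sB B0.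
  have := ctrlON (iffLR (simeqP _ _ _ _ _) V1 s0 s00 s0T).
  apply: ctrlO_near; near=> st.
  by rewrite /level1 /= subrr sub0r opprK.
have OA := vanish _ sA A0; split.
  have OB : O s0 2 (fun s t => bilin (fun a b => b *m 'D_a A (X.1 s)) (level2 X s t)).
    apply: (ctrlO_bilin_form (B := fun s a b => b *m 'D_a A (X.1 s))).
      move=> i j; exact: (ctrlO_derive_form i j s00 s0T openT sA).
    exact: WG_level2.
  apply: ctrlO_near (ctrlOB (ctrlO_weak T_gt0 p_gt0 w_control (isT : 2 <= 3)%N OA) OB).
  by near=> st; rewrite addrK.
have row_order (i : 'I_N) : O s0 3 (fun s t => row i (level2 X s t) *m A (X.1 s)).
  pose B (x : 'rV[R]_N) := x 0 i *: A x.
  have sx : smooth_on setT (fun x : 'rV[R]_N => x 0 i).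
    apply: smooth_on_entry; [exact: openT|exact: smooth_on_id].
  have sB : smooth_on setT B by apply: smooth_onZ => //; exact: openT.
  have B0 m v : M m -> tau d M m v -> v *m B m = 0.
    by move=> Mm tv; rewrite /B -scalemxAr A0 // scaler0.
  have Ox : O s0 0 (fun s t => X.1 s 0 i).
    exact: (ctrlO_trace X_WG s00 s0T (smooth_on_continuous sx I)).
  apply: ctrlO_near (ctrlOB (vanish _ sB B0) (ctrlOZ p_gt0 w_control Ox OA)).
  near=> st; set x := X.1 st.1; set A2 := level2 _ _ _; set h := level1 _ _ _.
  have dA : differentiable A x by exact: smooth_on_differentiable sA I.
  have dx : differentiable (fun x : 'rV[R]_N => x 0 i) x.
    exact: smooth_on_differentiable sx I.
  have DB a : 'D_a B x = a 0 i *: A x + x 0 i *: 'D_a A x.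
    have di : differentiable (@id 'rV[R]_N) x.
      exact: smooth_on_differentiable (@smooth_on_id R _ setT) I.
    rewrite /B deriveZ_fun //.
    by rewrite (@derive_entry R _ 1 N (@id 'rV[R]_N) 0 i x a di) derive_id.
  have -> : bilin (fun a b => b *m 'D_a B x) A2 =
      row i A2 *m A x + x 0 i *: bilin (fun a b => b *m 'D_a A x) A2.
    have -> : bilin (fun a b => b *m 'D_a B x) A2 =
        bilin (fun a b => a 0 i *: b *m A x + x 0 i *: (b *m 'D_a A x)) A2.
      by apply: eq_bilin => j l; rewrite DB mulmxDr -!scalemxAr -scalemxAl.
    rewrite bilin_add; congr (_ + _).
      rewrite (bilin_mulmx (fun a b => a 0 i *: b)); congr (_ *m _).
      rewrite /bilin (bigD1 i) //= [X in _ + X]big1 ?addr0; last first.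
        move=> j ji; rewrite big1 // => l _.
        by rewrite mxE eq_sym (negbTE ji) andbF scale0r scaler0.
      rewrite [RHS]row_sum_delta; apply: eq_bigr => l _.
      by rewrite !mxE !eqxx scale1r.
    rewrite /bilin scaler_sumr; apply: eq_bigr => j _.
    by rewrite scaler_sumr; apply: eq_bigr => l _; rewrite !scalerA mulrC.
  by rewrite /B -scalemxAr scalerDr opprD addrACA subrr add0r addrK.
have Oe (i : 'I_N) : O s0 0 (fun s t => delta_mx i 0 : 'cV[R]_N).
  apply: (@ctrlO_bounded R T p w s0 _ _ (`|delta_mx i 0 : 'cV[R]_N|)).
  by near=> st.
have := ctrlO_sum (index_enum 'I_N)
  (fun i => ctrlO_mulmx p_gt0 w_control (Oe i) (row_order i)).
apply: ctrlO_near; near=> st.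
rewrite [in RHS](sum_delta_row (level2 X st.1 st.2)) mulmx_suml.
by apply: eq_bigr => i _; rewrite mulmxA.
Unshelve. all: by end_near. Qed.

(** With [P] the matrix of the projection and [Q = 1 - P], one has
    [X - P^T X P = Q^T X + P^T X Q].  Here [X Q] is negligible since [X *m dF] is;
    transposing and using [X + X^T = x (x) x] reduces [Q^T X] to [X Q] and to
    [x (x) (x Q)], whose factors have orders one and two. *)
Lemma level2_projection s0 : 0 <= s0 -> s0 <= T ->
  O s0 3 (fun s t => level2 X s t - bilin (fun a b =>
    tens (tproj d M (X.1 s) a) (tproj d M (X.1 s) b)) (level2 X s t)).
Proof.
move=> s00 s0T; have Ms0 := X_M s00 s0T.
have [_ /(_ _ Ms0) [U [F eF]]] := M_submanifold.
have [oU Us0 sF _ _] := eF; have sJ := smooth_on_jacobian oU sF.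
have [chi schi [chi_gt0 chi0]] := bump_exists oU Us0.
have [C C0 resC] := tproj_residual M_submanifold eF.
pose A x := chi x *: jacobian F x.
have sA : smooth_on setT A by exact: smooth_on_cutoff chi0.
have A0 m v : M m -> tau d M m v -> v *m A m = 0.
  move=> Mm tv; have [Um|nUm] := pselect (U m); last first.
    by rewrite /A [chi m](nbhs_singleton (chi0 m nUm)) scale0r mulmx0.
  rewrite /A -scalemxAr.
  by rewrite (iffLR (tau_jacobianP v (local_equation_sub eF Um) Mm) tv) scaler0.
have [OhA OXA] := conormal_order s00 s0T sA A0.
have cchi : {for X.1 s0, continuous chi} by exact: smooth_on_continuous schi I.
have ichi : O s0 0 (fun s t => (chi (X.1 s))^-1).
  apply: (ctrlO_trace X_WG s00 s0T (g := fun x => (chi x)^-1)).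
  by apply: continuousV cchi; rewrite gt_eqF.
have chi_near : \forall st \near near_diag T s0, 0 < chi (X.1 st.1).
  have : nbhs (X.1 s0) [set x | 0 < chi x] by exact: (cvgr_gt _ cchi).
  by move=> /(WG_trace X_WG s00 s0T); apply: filterS => st [].
(* [chi] is bounded below near [x_s0], so the cut-off can be removed. *)
have uncut m (E : R -> R -> 'M[R]_(m, N)) q :
    O s0 q (fun s t => E s t *m A (X.1 s)) ->
    O s0 q (fun s t => E s t *m jacobian F (X.1 s)).
  move=> OE; apply: ctrlO_near (ctrlOZ p_gt0 w_control ichi OE).
  apply: filterS chi_near => st chi_st.
  by rewrite /A -scalemxAr scalerA mulVf ?scale1r // gt_eqF.
have OhJ := uncut _ _ _ OhA; have OXJ := uncut _ _ _ OXA.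
pose P s : 'M[R]_N := \matrix_i tproj d M (X.1 s) 'e_i.
have nU := near_trace_mfd s00 s0T oU Us0.
have PE s v : M (X.1 s) -> v *m P s = tproj d M (X.1 s) v.
  move=> Ms; rewrite mulmx_sum_row.
  rewrite (@linear_row_sum _ _ _ (tproj d M (X.1 s)) v); last first.
    by move=> c a b; exact: tproj_lin.
  by apply: eq_bigr => i _; rewrite rowK.
have res_near : \forall st \near near_diag T s0, forall v : 'rV[R]_N,
    `|v - v *m P st.1| <= C * `|v *m jacobian F (X.1 st.1)|.
  apply: filterS2 (WG_trace X_WG s00 s0T resC) nU => st [resS _] [_ Ms _ _ _] v.
  by rewrite PE //; exact: resS.
have residual m (E : R -> R -> 'M[R]_(m, N)) q :
    O s0 q (fun s t => E s t *m jacobian F (X.1 s)) ->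
    O s0 q (fun s t => E s t - E s t *m P s).
  apply: (ctrlO_dom (K := C)); apply: filterS res_near => st resS.
  apply: mx_norm_row_le => [|i]; first by rewrite mulr_ge0 // ltW.
  rewrite linearB /= !row_mul (le_trans (resS _)) // ler_wpM2l ?(ltW C0) //.
  by rewrite -row_mul row_norm_le.
have OP : O s0 0 (fun s t => P s).
  apply: (@ctrlO_bounded R T p w s0 _ _ (N%:R * 1)).
  apply: filterS nU => st [_ Ms _ _ _].
  apply: mx_norm_row_le => [|i]; first by rewrite mulr_ge0.
  rewrite rowK (le_trans (tproj_norm _ _ Ms)) // ler_wpM2l //.
  apply: mx_norm_le => // a b; rewrite mxE.
  by case: (_ && _); rewrite ?normr1 ?normr0.
have Oh := WG_level1 p_gt0 w_control X_WG s0.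
have OXQ := residual _ _ _ OXJ; have OhQ := residual _ _ _ OhJ.
have OhhQ := ctrlO_mulmx p_gt0 w_control (ctrlO_tr Oh) OhQ.
have OPXQ := ctrlO_mulmx p_gt0 w_control (ctrlO_tr OP) OXQ.
apply: ctrlO_near (ctrlOD (ctrlO_tr (ctrlOB OhhQ OXQ)) OPXQ).
apply: filterS nU => -[s t] /= [[/= s_ge0 [st tT]] Ms _ _ _].
have sym := WG_symmetric X_WG s_ge0 st tT.
have -> : bilin (fun a b => tens (tproj d M (X.1 s) a) (tproj d M (X.1 s) b))
    (level2 X s t) = (P s)^T *m level2 X s t *m P s.
  by rewrite -bilin_tens_mulmx; apply: eq_bilin => i j; rewrite !PE.
move: (level2 X s t) (level1 X s t) (P s) sym => A2 h Q sym.
have -> : h^T *m (h - h *m Q) - (A2 - A2 *m Q) = A2^T - A2^T *m Q.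
  rewrite mulmxBr mulmxA -[h^T *m h]/(tens h h) -sym mulmxDl.
  move: (A2 *m Q) (A2^T *m Q) => B B'.
  by apply/matrixP => i j; rewrite !mxE; ring.
rewrite linearB /= trmx_mul !trmxK mulmxBr mulmxA addrA subrK.
by [].
Unshelve. all: by end_near. Qed.

Lemma one_form_id : one_form d M (fun _ v : 'rV[R]_N => v).
Proof.
move=> m _; exists setT, (fun=> 1%:M); split=> //; split; first exact: openT.
  exact: smooth_on_cst.
by move=> x v _ _ _; rewrite mulmx1.
Qed.

(** The extension [1%:M] is constant, so both expansions hold without error. *)
Lemma rough_integral_id :
  is_rough_integral_mfd T p w d M (fun _ v : 'rV[R]_N => v) X
    (fun t => X.1 t - X.1 0, X.2).
Proof.
exists setT, (fun=> 1%:M); split=> //.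
  split; [exact: openT|exact: smooth_on_cst|].
  by move=> x v _ _ _; rewrite mulmx1.
have L1 s t : level1 (fun t => X.1 t - X.1 0, X.2) s t = level1 X s t.
  by rewrite /level1 /= opprB addrA subrK.
have [cX [cX2 [chen [l1 [l2 sym]]]]] := X_WG.
split=> /=.
- split=> /=.
    move=> t; apply: continuousB; first exact: cX.
    exact: cst_continuous.
  split=> //; split=> [s u t s0 su ut tT|]; first by rewrite !L1; exact: chen.
  split; first by have [C XC] := l1; exists C => s t s0 st tT; rewrite L1; exact: XC.
  by split=> // s t s0 st tT; rewrite L1; exact: sym.
- by rewrite subrr.
- exists 1, 0; split=> // s t _ _ _ _; rewrite L1 mulmx1 opprD addrA subrr sub0r.
  rewrite normrN [bilin _ _](_ : _ = 0) ?normr0 ?mul0r //.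
  rewrite /bilin big1 // => i _; rewrite big1 // => j _.
  by rewrite derive_cst mulmx0 scaler0.
- exists 1, 0; split=> // s t _ _ _ _.
  by rewrite bilin_tens_mulmx mulmx1 trmx1 mul1mx subrr normr0 mul0r.
Qed.

Lemma smooth_on_mfd_id : smooth_on_mfd M (@id 'rV[R]_N).
Proof.
move=> m _; exists setT, id; split=> //; first exact: openT.
exact: smooth_on_id.
Qed.

Lemma simeq_trans (V : normedModType R) (f g h : R -> R -> V) :
  simeq T p w f g -> simeq T p w g h -> simeq T p w f h.
Proof.
move=> /simeqP fg /simeqP gh; apply/simeqP => s0 s00 s0T.
apply: ctrlO_near (ctrlOD (fg _ s00 s0T) (gh _ s00 s0T)).
by near=> st; rewrite subrKA.
Unshelve. all: by end_near. Qed.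

Lemma simeq_eq (V : normedModType R) (f g : R -> R -> V) :
  (forall s t, 0 <= s -> s <= T -> f s t = g s t) -> simeq T p w f g.
Proof.
move=> fg; exists 1, 0; split=> // s t s0 st tT _.
by rewrite fg ?(le_trans st) // subrr normr0 mul0r.
Qed.

(** On [M] the derivative of the identity along [Y_a] is [Y_a]; the missing
    normal part of the second level is [level2_projection]. *)
Lemma solution_of_functions : X.1 0 = x0 ->
  (simeq T p w (fun s t => X.1 t - X.1 s) (fun s t =>
    lie M (Y (level1 Z s t)) (@id 'rV[R]_N) (X.1 s) +
    bilin (fun a b => lie M (Y a) (lie M (Y b) (@id 'rV[R]_N)) (X.1 s))
      (level2 Z s t))) ->
  simeq T p w
    (fun s t => bilin (fun a b =>
      tens (mderive M (@id 'rV[R]_N) (X.1 s) (tproj d M (X.1 s) a))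
           (mderive M (@id 'rV[R]_N) (X.1 s) (tproj d M (X.1 s) b))) (level2 X s t))
    (fun s t => bilin (fun a b =>
      tens (lie M (Y a) (@id 'rV[R]_N) (X.1 s)) (lie M (Y b) (@id 'rV[R]_N) (X.1 s)))
      (level2 Z s t)) ->
  solves_RDE T p w M Y Z x0 X.
Proof.
have lieE a m : M m -> lie M (Y a) (@id 'rV[R]_N) m = Y a m.
  by move=> Mm; rewrite /lie (mderive_id (d := d)) //; exact: (Y_field a).2.
move=> X_start H1 H2; split=> //.
  apply: simeq_trans H1 _; apply: simeq_eq => s t s0 sT; have Ms := X_M s0 sT.
  rewrite lieE //; congr (_ + _); apply: eq_bilin => i j.
  exact: mderive_ext (fun m => lieE _ m).
apply: (@simeq_trans _ _ (fun s t => bilin (fun a b =>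
    tens (tproj d M (X.1 s) a) (tproj d M (X.1 s) b)) (level2 X s t))).
  apply/simeqP => s0 s00 s0T.
  exact: (level2_projection s00 s0T).
apply: (simeq_trans _ (simeq_trans H2 _)); apply: simeq_eq => s t s0 sT;
  have Ms := X_M s0 sT; apply: eq_bilin => i j.
  by rewrite !(mderive_id (d := d)) //; exact: (tproj_spec M_submanifold _ Ms).1.
by rewrite !lieE.
Qed.

End equivalence.

Theorem theorem4p5 (R : realType) (T p : R) (w : R -> R -> R)
    (N d n : nat) (M : set 'rV[R]_N)
    (Y : 'rV[R]_n -> 'rV[R]_N -> 'rV[R]_N)
    (Z : rpath R n) (X : rpath R N) (x0 : 'rV[R]_N)
    (T_gt0 : 0 < T) (p_ge2 : 2 <= p) (p_lt3 : p < 3)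
    (w_control : control T w)
    (M_submanifold : embedded_submanifold d M)
    (Y_linear : linear_vector_fields d M Y)
    (Z_rough : WG T p w Z)
    (X_rough : WGM T p w d M X)
    (x0_M : M x0) (X_start : X.1 0 = x0) :
  let item1 := solves_RDE T p w M Y Z x0 X in
  let item2 :=
    forall (k : nat) (al : 'rV[R]_N -> 'rV[R]_N -> 'rV[R]_k),
      one_form d M al ->
      forall V : rpath R k, is_rough_integral_mfd T p w d M al X V ->
        simeq T p w (level1 V) (fun s t =>
          al (X.1 s) (Y (level1 Z s t) (X.1 s)) +
          bilin (fun a b => lie M (Y a) (fun m => al m (Y b m)) (X.1 s))
            (level2 Z s t))
        /\
        simeq T p w (level2 V) (fun s t =>
          bilin (fun a b =>
            tens (al (X.1 s) (Y a (X.1 s))) (al (X.1 s) (Y b (X.1 s))))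
            (level2 Z s t)) in
  let item3 :=
    forall (k : nat) (f : 'rV[R]_N -> 'rV[R]_k),
      smooth_on_mfd M f ->
        simeq T p w (fun s t => f (X.1 t) - f (X.1 s)) (fun s t =>
          lie M (Y (level1 Z s t)) f (X.1 s) +
          bilin (fun a b => lie M (Y a) (lie M (Y b) f) (X.1 s))
            (level2 Z s t))
        /\
        simeq T p w
          (fun s t =>
            bilin (fun a b =>
              tens (mderive M f (X.1 s) (tproj d M (X.1 s) a))
                   (mderive M f (X.1 s) (tproj d M (X.1 s) b)))
              (level2 X s t))
          (fun s t =>
            bilin (fun a b =>
              tens (lie M (Y a) f (X.1 s)) (lie M (Y b) f (X.1 s)))
              (level2 Z s t)) in
  (item1 <-> item2) /\ (item1 <-> item3) /\ (item2 <-> item3).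
Proof.
move=> item1 item2 item3.
have p_gt0 : 0 < p by rewrite (lt_le_trans _ p_ge2).
have [Y_field _] := Y_linear.
have i12 : item1 -> item2.
  move=> sol k al _ V.
  exact: (solution_rough_integral p_gt0 w_control Y_field X_rough sol).
have i21 : item2 -> item1.
  move=> h2; have [H1 H2] := h2 N (fun _ v => v) (@one_form_id R N d M) _
    (rough_integral_id X_rough).
  split=> //; apply: simeq_trans H1; apply: simeq_eq => s t _ _.
  by rewrite /level1 /= opprB addrA subrK.
have i13 : item1 -> item3.
  move=> sol k f sf.
  exact: (solution_function p_gt0 w_control M_submanifold Y_field X_rough sol).
have i31 : item3 -> item1.
  move=> /(_ _ _ (@smooth_on_mfd_id R N M)) [H1 H2].
  exact: (solution_of_functions T_gt0 p_gt0 w_control M_submanifold Y_field X_rough).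
tauto.
Qed.
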